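(* Let $R=A[\frac1\pi]$. The Hodge filtration $\mathcal{F}_{H}:\mathrm{Mod}_{R,f}^{\varphi}\rightarrow\mathrm{Fil}_{K^{\prime}}^{\mathbb{Z}}$ is compatible with tensor products, duals, symmetric and exterior powers. For every exact sequence \[ 0\rightarrow(M_{1},\varphi_{1})\rightarrow(M_{2},\varphi_{2})\rightarrow(M_{3},\varphi_{3})\rightarrow0 \] in $\mathrm{Mod}_{R,f}^{\varphi}$ with $r_{i}=\mathrm{rank}\, M_{i}$ (so that $r_{2}=r_{1}+r_{3}$), we have \[ t_{H}(M_{1},\varphi_{1})\ast t_{H}(M_{3},\varphi_{3})\leq t_{H}(M_{2},\varphi_{2})\quad\text{in}\quad\mathbb{Z}_{\geq}^{r_{2}} \] with equality if and only if for every $\gamma\in\mathbb{Z}$, the complex of $K'$-vector spaces \[ 0\rightarrow\mathcal{F}_{H}^{\gamma}(M_{1},\varphi_{1})\rightarrow\mathcal{F}_{H}^{\gamma}(M_{2},\varphi_{2})\rightarrow\mathcal{F}_{H}^{\gamma}(M_{3},\varphi_{3})\rightarrow0 \] is exact. The Hodge filtration $\mathcal{F}_{H}^{\iota}:\mathrm{Mod}_{R,f}^{\varphi}\rightarrow\mathrm{Fil}_{K}^{\mathbb{Z}}$ has the analogous properties: it is compatible with tensor products, duals, symmetric and exterior powers, and for every exact sequence $0\rightarrow(M_{1},\varphi_{1})\rightarrow(M_{2},\varphi_{2})\rightarrow(M_{3},\varphi_{3})\rightarrow0$ in $\mathrm{Mod}_{R,f}^{\varphi}$ with $r_{i}=\mathrm{rank}\,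 M_{i}$, we have $t_H^\iota(M_1,\varphi_1)\ast t_H^\iota(M_3,\varphi_3)\le t_H^\iota(M_2,\varphi_2)$ in $\mathbb{Z}_{\geq}^{r_{2}}$ with equality if and only if the complexes $0\to(\mathcal{F}_H^{\iota})^\gamma(M_1,\varphi_1)\to(\mathcal{F}_H^{\iota})^\gamma(M_2,\varphi_2)\to(\mathcal{F}_H^{\iota})^\gamma(M_3,\varphi_3)\to0$ of $K$-vector spaces are exact for every $\gamma\in\mathbb{Z}$.
   Context: $E$ is a finite extension of $\mathbb{Q}_p$ with uniformizer $\pi$ and residue field $\mathbb{F}_q$, $K$ a perfectoid field extension of $E$, $A=W_{\mathcal{O}_E}(\mathcal{O}_K^\flat)$, where $\mathcal{O}_K^\flat$ is the valuation ring of the tilt $K^\flat$; $\varphi$ is the Frobenius automorphism of $A$ lifting $x\mapsto x^q$; $\xi$ is a generator of the kernel of the usual surjection $\theta:A\twoheadrightarrow\mathcal{O}_K$, $\xi'=\varphi(\xi)$. $B_{dR}^+$ (resp. $B_{dR}'^+$) is the completion of the local ring of $A[\frac1\pi]$ at the maximal ideal generated by $\xi$ (resp. $\xi'$): a complete discrete valuation ring with uniformizer $\xi$ (resp. $\xi'$), residue field $K$ (resp. $K'$) and fraction field $B_{dR}$ (resp. $B'_{dR}$). $\mathrm{Mod}_{R,f}^{\varphi}$ ($R=A[\frac1\pi]$) is the category of finite free $R$-modules $M$ with an isomorphism $\varphi_M:(\varphi^*M)[\xi'^{-1}]\to M[\xi'^{-1}]$; short exact sequences are those which are exact on underlying modules;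 tensor constructions are the obvious ones. $\mathrm{Fil}^{\mathbb{Z}}_{k}$ is the category of finite dimensional $k$-vector spaces with a decreasing, exhaustive, separated $\mathbb{Z}$-filtration, with its usual tensor product, duals, symmetric and exterior powers. For a discrete valuation ring $S$ with uniformizer $u$ and $S$-lattices $L_1,L_2$ in a finite dimensional $\mathrm{Frac}(S)$-vector space, $\mathcal{F}(L_1,L_2)$ is the $\mathbb{Z}$-filtration on $L_1/uL_1$ given by $\mathcal{F}^\gamma=(L_1\cap u^\gamma L_2+uL_1)/uL_1$. Set $\mathcal{F}_H(M,\varphi_M)=\mathcal{F}\big(M\otimes B_{dR}'^+,\varphi_M((\varphi^*M)\otimes B_{dR}'^+)\big)$ on $M\otimes K'$, and, with $\psi=(\varphi^{-1})^*(\varphi_M):M\otimes B_{dR}\to((\varphi^{-1})^*M)\otimes B_{dR}$, $\mathcal{F}_H^\iota(M,\varphi_M)=\mathcal{F}\big(M\otimes B_{dR}^+,\psi^{-1}(((\varphi^{-1})^*M)\otimes B_{dR}^+)\big)$ on $M\otimes K$. Their types $t_H,t_H^\iota\in\mathbb{Z}^r_\ge=\{(\gamma_1\ge\dots\ge\gamma_r)\}$ contain $\gamma$ with multiplicity the dimension of the $\gamma$-th graded piece. On $\mathbb{Z}^r_\ge$: $(\gamma_i)\le(\gamma_i')$ iff $\gamma_1+\dots+\gamma_s\le\gamma'_1+\dots+\gamma'_s$ for all $s\le r$ with equality for $s=r$. $\ast$ concatenates and reorders. *)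

(* Defs.v *)
From HB Require Import structures.
From mathcomp Require Import all_boot all_order perm all_algebra fieldext.
From mathcomp Require Import boolp classical_sets reals.

Set Implicit Arguments.
Unset Strict Implicit.
Unset Printing Implicit Defensive.

Import Order.TTheory GRing.Theory Num.Theory.

Local Open Scope classical_set_scope.
Local Open Scope ring_scope.

Definition is_quotient (A B : comNzRingType) (f : {rmorphism A -> B}) (u : A) :=
  (forall b, exists a, f a = b) /\
  (forall a, f a = 0 <-> exists c, a = u * c).

Definition is_localization (A : comNzRingType) (L : comUnitRingType)
    (f : {rmorphism A -> L}) (S : set A) :=
  [/\ forall s, S s -> f s \is a GRing.unit,
      forall x, exists a s, S s /\ x = f a / f s
    & forall a, f a = 0 -> exists s, S s /\ s * a = 0].

Definition powers (A : comNzRingType) (u : A) : set A :=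
  [set a | exists n, a = u ^+ n].

Definition adically_complete (B : comNzRingType) (u : B) :=
  (forall b, (forall n, exists c, b = u ^+ n * c) -> b = 0) /\
  (forall s : nat -> B, (forall n, exists c, s n.+1 - s n = u ^+ n * c) ->
     exists l, forall n, exists c, l - s n = u ^+ n * c).

(* [f] exhibits [B] as the completion lim_n L/u^n. *)
Definition is_adic_completion (L B : comNzRingType) (f : {rmorphism L -> B})
    (u : L) :=
  [/\ adically_complete (f u),
      forall n b, exists a c, b = f a + f u ^+ n * c
    & forall n a, (exists c, f a = f u ^+ n * c) -> exists c, a = u ^+ n * c].

Record absval (RR : realType) (K : fieldType) := AbsVal {
  av :> K -> RR;
  av_ge0 : forall x, 0 <= av x;
  av_eq0 : forall x, av x = 0 -> x = 0;
  av_0 : av 0 = 0;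
  av_M : forall x y, av (x * y) = av x * av y;
  av_D : forall x y, av (x + y) <= Num.max (av x) (av y) }.

Section ValuationRing.
Variables (RR : realType) (K : fieldType) (v : absval RR K).

Lemma av_1 : v 1 = 1.
Proof.
have v1 : v 1 != 0 by apply/eqP => /(@av_eq0 _ _ v)/eqP; rewrite oner_eq0.
by apply: (mulfI v1); rewrite -av_M !mulr1.
Qed.

Lemma av_N1 : v (-1) = 1.
Proof.
apply/eqP; rewrite -(@eqrXn2 _ 2%N) ?av_ge0 //.
by rewrite expr1n expr2 -av_M mulrNN mulr1 av_1.
Qed.

Definition av_int : K -> bool := fun x => v x <= 1.

Fact av_int_subring : subring_closed av_int.
Proof.
split; rewrite /av_int /in_mem /=.
- by rewrite av_1.
- move=> x y; rewrite /in_mem /= => vx vy; apply: le_trans (av_D v _ _) _.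
  by rewrite ge_max vx -mulN1r av_M av_N1 mul1r.
- move=> x y; rewrite /in_mem /= => vx vy.
  by rewrite av_M mulr_ile1 ?av_ge0.
Qed.

HB.instance Definition _ := GRing.isSubringClosed.Build K av_int av_int_subring.

Record valring := ValRing { valring_val :> K; _ : av_int valring_val }.

HB.instance Definition _ := [isSub for valring_val].
HB.instance Definition _ := [Choice of valring by <:].
HB.instance Definition _ := [SubChoice_isSubComNzRing of valring by <:].

Definition av_lim (u : nat -> K) (l : K) :=
  forall e : RR, 0 < e -> exists N, forall n, (N <= n)%N -> v (u n - l) < e.

Definition av_complete :=
  forall u : nat -> K,
    (forall e : RR, 0 < e -> exists N, forall m n,
       (N <= m)%N -> (N <= n)%N -> v (u m - u n) < e) ->
    exists l, av_lim u l.

End ValuationRing.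

(* The completion of the rationals for the p-adic absolute value. *)
Definition is_Qp (RR : realType) (p : nat) (Q : fieldType) (v : absval RR Q) :=
  [/\ forall n, (0 < n)%N -> v n%:R = p%:R ^- logn p n,
      forall x (e : RR), 0 < e -> exists r : rat, v (x - ratr r) < e
    & av_complete v].

Record local_field (RR : realType) := LocalField {
  lf_p : nat;
  lf_p_prime : prime lf_p;
  lf_Qp : fieldType;
  lf_Qp_abs : absval RR lf_Qp;
  lf_QpP : is_Qp lf_p lf_Qp_abs;
  lf_E :> fieldExtType lf_Qp;
  lf_abs : absval RR lf_E;
  lf_abs_ext : forall x : lf_Qp, lf_abs x%:A = lf_Qp_abs x;
  lf_pi : valring lf_abs;
  lf_pi_neq0 : lf_pi != 0;
  lf_piP : forall x : valring lf_abs, lf_abs x < 1 <-> exists y, x = lf_pi * y;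
  lf_Fq : finFieldType;
  lf_res : {rmorphism valring lf_abs -> lf_Fq};
  lf_resP : is_quotient lf_res lf_pi }.

Definition lf_q RR (E : local_field RR) : nat := #|lf_Fq E|.

(* Nondiscrete rank one, complete, residue characteristic [p], and Frobenius *)
(* surjective on O_K/p.                                                      *)
Definition is_perfectoid (RR : realType) (p : nat) (K : fieldType)
    (v : absval RR K) :=
  [/\ av_complete v,
      forall c : RR, c < 1 -> exists x, c < v x < 1,
      v p%:R < 1
    & forall x, v x <= 1 -> exists y, v y <= 1 /\ v (x - y ^+ p) <= v p%:R].

(* The rank one valuation of [K] is only defined up to a positive real power; *)
(* it is normalized here so as to extend the absolute value of [E].           *)
Record perfectoid_ext (RR : realType) (E : local_field RR) := PerfectoidExt {
  pe_K :> fieldType;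
  pe_abs : absval RR pe_K;
  pe_perfectoid : is_perfectoid (lf_p E) pe_abs;
  pe_emb : {rmorphism E -> pe_K};
  pe_abs_ext : forall x, pe_abs (pe_emb x) = lf_abs E x }.

(* The tilt is the set of sequences (sharp 0 x, sharp 1 x, ...) in [K] with   *)
(* (sharp n.+1 x)^p = sharp n x, with its usual field structure.              *)
Record tilt (RR : realType) (E : local_field RR) (K : perfectoid_ext E) := Tilt {
  tl_field :> fieldType;
  tl_sharp : nat -> tl_field -> K;
  tl_sharpX : forall n x, tl_sharp n.+1 x ^+ lf_p E = tl_sharp n x;
  tl_sharp_inj : forall x y, (forall n, tl_sharp n x = tl_sharp n y) -> x = y;
  tl_sharp_surj : forall u : nat -> K, (forall n, u n.+1 ^+ lf_p E = u n) ->
    exists x, forall n, tl_sharp n x = u n;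
  tl_sharpM : forall n x y, tl_sharp n (x * y) = tl_sharp n x * tl_sharp n y;
  tl_sharpD : forall n x y,
    av_lim (pe_abs K)
      (fun m => (tl_sharp (n + m) x + tl_sharp (n + m) y) ^+ (lf_p E ^ m))
      (tl_sharp n (x + y));
  tl_abs : absval RR tl_field;
  tl_absE : forall x, tl_abs x = pe_abs K (tl_sharp 0 x) }.

(* [A] is the pi-adically complete, pi-torsion free O_E-algebra lifting the   *)
(* perfect ring O_K^flat, which characterizes W_{O_E}(O_K^flat);              *)
(* [ai_teich] is x |-> [x], and theta is the morphism of O_E-algebras with    *)
(* theta [x] = sharp 0 x.  The F_q-algebra structure on O_K^flat for which    *)
(* [ai_red] is a morphism is the usual one by the existence of theta.         *)
Record ainf (RR : realType) (E : local_field RR) (K : perfectoid_ext E)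
    (Kf : tilt K) := Ainf {
  ai_ring :> comNzRingType;
  ai_struct : {rmorphism valring (lf_abs E) -> ai_ring};
  ai_red : {rmorphism ai_ring -> valring (tl_abs Kf)};
  ai_redP : is_quotient ai_red (ai_struct (lf_pi E));
  ai_complete : adically_complete (ai_struct (lf_pi E));
  ai_torsion_free : forall a, ai_struct (lf_pi E) * a = 0 -> a = 0;
  ai_teich : valring (tl_abs Kf) -> ai_ring;
  ai_teichK : forall x, ai_red (ai_teich x) = x;
  ai_teichM : forall x y, ai_teich (x * y) = ai_teich x * ai_teich y;
  ai_phi : {rmorphism ai_ring -> ai_ring};
  ai_phi_bij : bijective ai_phi;
  ai_phi_struct : forall x, ai_phi (ai_struct x) = ai_struct x;
  ai_phi_red : forall a, ai_red (ai_phi a) = ai_red a ^+ lf_q E;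
  ai_theta : {rmorphism ai_ring -> valring (pe_abs K)};
  ai_theta_struct : forall x : valring (lf_abs E),
    valring_val (ai_theta (ai_struct x)) = pe_emb K (valring_val x);
  ai_theta_teich : forall x : valring (tl_abs Kf),
    valring_val (ai_theta (ai_teich x)) = tl_sharp 0 (valring_val x);
  ai_xi : ai_ring;
  ai_xiP : is_quotient ai_theta ai_xi }.

(* For [th : R -> k] with kernel the maximal ideal (u): the completed local   *)
(* ring of [R] at (u), its residue map onto [k], and its fraction field.      *)
Record dR_ring (R : comUnitRingType) (u : R) (k : fieldType)
    (th : {rmorphism R -> k}) := DRRing {
  dr_loc : comUnitRingType;
  dr_to_loc : {rmorphism R -> dr_loc};
  dr_locP : is_localization dr_to_loc [set s | ~ exists c, s = u * c];
  dr_plus :> comNzRingType;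
  dr_compl : {rmorphism dr_loc -> dr_plus};
  dr_complP : is_adic_completion dr_compl (dr_to_loc u);
  dr_res : {rmorphism dr_plus -> k};
  dr_res_th : forall x, dr_res (dr_compl (dr_to_loc x)) = th x;
  dr_resP : is_quotient dr_res (dr_compl (dr_to_loc u));
  dr_frac : fieldType;
  dr_to_frac : {rmorphism dr_plus -> dr_frac};
  dr_fracP : is_localization dr_to_frac [set s | s != 0] }.

Definition dr_unif (R : comUnitRingType) (u : R) (k : fieldType)
  (th : {rmorphism R -> k}) (B : dR_ring u th) : B :=
  dr_compl B (dr_to_loc B u).

Definition dr_emb (R : comUnitRingType) (u : R) (k : fieldType)
  (th : {rmorphism R -> k}) (B : dR_ring u th) : R -> dr_frac B :=
  fun x => dr_to_frac B (dr_compl B (dr_to_loc B x)).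

(* [bk_R] is R = A[1/pi] and [bk_Rx] is R[1/xi'].  The morphism [bk_to_BdR]   *)
(* is the composite R[1/xi'] -> R[1/xi] -> B_dR of phi^-1 and the inclusion.  *)
Record bk_rings (RR : realType) (E : local_field RR) (K : perfectoid_ext E)
    (Kf : tilt K) (A : ainf Kf) := BKRings {
  bk_R :> comUnitRingType;
  bk_to_R : {rmorphism A -> bk_R};
  bk_RP : is_localization bk_to_R (powers (ai_struct A (lf_pi E)));
  bk_phi : {rmorphism bk_R -> bk_R};
  bk_phiE : forall a, bk_phi (bk_to_R a) = bk_to_R (ai_phi A a);
  bk_Rx : comUnitRingType;
  bk_to_Rx : {rmorphism bk_R -> bk_Rx};
  bk_RxP : is_localization bk_to_Rx (powers (bk_to_R (ai_phi A (ai_xi A))));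
  bk_theta : {rmorphism bk_R -> pe_K K};
  bk_thetaE : forall a, bk_theta (bk_to_R a) = valring_val (ai_theta A a);
  bk_B : dR_ring (bk_to_R (ai_xi A)) bk_theta;
  bk_K' : fieldType;
  bk_theta' : {rmorphism bk_R -> bk_K'};
  bk_theta'P : is_quotient bk_theta' (bk_to_R (ai_phi A (ai_xi A)));
  bk_B' : dR_ring (bk_to_R (ai_phi A (ai_xi A))) bk_theta';
  bk_to_BdR' : {rmorphism bk_Rx -> dr_frac bk_B'};
  bk_to_BdR'E : forall x, bk_to_BdR' (bk_to_Rx x) = dr_emb bk_B' x;
  bk_to_BdR : {rmorphism bk_Rx -> dr_frac bk_B};
  bk_to_BdRE : forall x, bk_to_BdR (bk_to_Rx (bk_phi x)) = dr_emb bk_B x }.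

(* A finite free R-module is a [vectType R], and its base change along        *)
(* [f : R -> S] is realized as ['rV[S]_(dim M)], with [bc_vec f] the map      *)
(* x |-> x (x) 1 in the coordinates given by the [vectType] structure.        *)
Section BaseChange.
Variables (R S : comNzRingType) (f : R -> S).

Definition bc_vec (M : vectType R) (x : M) : 'rV[S]_(dim M) :=
  map_mx f (VectorInternalTheory.v2r x).

Definition base_vec (M : vectType R) (i : 'I_(dim M)) : M :=
  VectorInternalTheory.r2v (delta_mx 0 i).

Definition bc_lin (M N : vectType R) (g : M -> N) (x : 'rV[S]_(dim M)) :
    'rV[S]_(dim N) :=
  \sum_i x 0 i *: bc_vec (g (base_vec i)).

Definition bc_bilin (M N P : vectType R) (b : M -> N -> P)
    (x : 'rV[S]_(dim M)) (y : 'rV[S]_(dim N)) : 'rV[S]_(dim P) :=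
  \sum_i \sum_j (x 0 i * y 0 j) *: bc_vec (b (base_vec i) (base_vec j)).

Definition bc_form (M N : vectType R) (b : M -> N -> R)
    (x : 'rV[S]_(dim M)) (y : 'rV[S]_(dim N)) : S :=
  \sum_i \sum_j x 0 i * y 0 j * f (b (base_vec i) (base_vec j)).

Definition bc_multilin (M P : vectType R) n (s : {ffun 'I_n -> M} -> P)
    (x : {ffun 'I_n -> 'rV[S]_(dim M)}) : 'rV[S]_(dim P) :=
  \sum_(h : {ffun 'I_n -> 'I_(dim M)})
    (\prod_j x j 0 (h j)) *: bc_vec (s [ffun j => base_vec (h j)]).

End BaseChange.

Section MultilinearAlgebra.
Variable R : comNzRingType.
Implicit Types M N T D : vectType R.

Definition is_bilinear (M N T : lmodType R) (b : M -> N -> T) :=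
  (forall a x x' y, b (a *: x + x') y = a *: b x y + b x' y) /\
  (forall a x y y', b x (a *: y + y') = a *: b x y + b x y').

Definition is_multilinear (M T : lmodType R) n (s : {ffun 'I_n -> M} -> T) :=
  forall (x : {ffun 'I_n -> M}) j a u v,
    let upd w := [ffun i => if i == j then w else x i] in
    s (upd (a *: u + v)) = a *: s (upd u) + s (upd v).

Definition is_symmetric (M T : lmodType R) n (s : {ffun 'I_n -> M} -> T) :=
  forall (x : {ffun 'I_n -> M}) (w : {perm 'I_n}), s [ffun i => x (w i)] = s x.

Definition is_alternating (M T : lmodType R) n (s : {ffun 'I_n -> M} -> T) :=
  forall (x : {ffun 'I_n -> M}) i j, i != j -> x i = x j -> s x = 0.

Definition factors_uniquely (X : Type) (T P : lmodType R) (s : X -> T)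
    (c : X -> P) :=
  exists g : {linear T -> P}, (forall x, g (s x) = c x) /\
    (forall g' : {linear T -> P}, (forall x, g' (s x) = c x) -> g' =1 g).

Definition is_tensor M N T (b : M -> N -> T) :=
  is_bilinear b /\
  forall (P : lmodType R) (c : M -> N -> P), is_bilinear c ->
    factors_uniquely (fun z : M * N => b z.1 z.2) (fun z => c z.1 z.2).

Definition is_dual M D (e : D -> M -> R) :=
  is_bilinear (e : D -> M -> R^o) /\
  forall h : {linear M -> R^o},
    exists d, (forall x, e d x = h x) /\
      forall d', (forall x, e d' x = h x) -> d' = d.

Definition is_sym_power M T n (s : {ffun 'I_n -> M} -> T) :=
  [/\ is_multilinear s, is_symmetric s
    & forall (P : lmodType R) (c : {ffun 'I_n -> M} -> P),
        is_multilinear c -> is_symmetric c -> factors_uniquely s c].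

Definition is_ext_power M T n (s : {ffun 'I_n -> M} -> T) :=
  [/\ is_multilinear s, is_alternating s
    & forall (P : lmodType R) (c : {ffun 'I_n -> M} -> P),
        is_multilinear c -> is_alternating c -> factors_uniquely s c].

End MultilinearAlgebra.

(* Exactness of 0 -> A -> B -> C -> 0 on subgroups A, B, C of U, V, W. *)
Definition short_exact (U V W : zmodType) (A : set U) (B : set V) (C : set W)
    (f : U -> V) (g : V -> W) :=
  [/\ forall x, A x -> B (f x),
      forall y, B y -> C (g y),
      forall x, A x -> f x = 0 -> x = 0,
      forall y, B y -> (g y = 0 <-> exists x, A x /\ f x = y)
    & forall z, C z -> exists y, B y /\ g y = z].

Section Filtrations.
Variable k : fieldType.

Lemma set_vspace n (P : set 'rV[k]_n) :
  P 0 -> (forall a x y, P x -> P y -> P (a *: x + y)) ->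
  exists U : {vspace 'rV[k]_n}, forall x, x \in U <-> P x.
Proof.
move=> P0 PL; pose Q m := `[< exists U : {vspace 'rV[k]_n},
  (forall x, x \in U -> P x) /\ \dim U = m >].
have Q0 : exists m, Q m.
  exists 0%N; apply/asboolP; exists 0%VS; rewrite dimv0; split=> // x.
  by rewrite memv0 => /eqP ->.
have Qb m : Q m -> (m <= \dim {:'rV[k]_n})%N.
  by move=> /asboolP [U [_ <-]]; exact/dimvS/subvf.
case: (ex_maxnP Q0 Qb) => m /asboolP [U [UP dU]] maxm.
exists U => x; split; first exact: UP.
move=> Px; have /maxm : Q (\dim (<[x]> + U)).
  apply/asboolP; exists (<[x]> + U)%VS; split=> // y.
  by move=> /memv_addP [_ /vlineP [a ->] [z Uz ->]]; exact: PL (UP _ Uz).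
rewrite -dU => dle; have /eqP -> : U == (<[x]> + U)%VS.
  by rewrite eqEdim addvSr.
by rewrite (subvP (addvSl _ _)) ?memv_line.
Qed.

Definition vspace_of n (P : set 'rV[k]_n) : {vspace 'rV[k]_n} :=
  xget 0%VS [set U | forall x, x \in U <-> P x].

Lemma vspace_ofP n (P : set 'rV[k]_n) :
  P 0 -> (forall a x y, P x -> P y -> P (a *: x + y)) ->
  forall x, x \in vspace_of P <-> P x.
Proof.
move=> P0 PL; have [U UP] := set_vspace P0 PL.
by rewrite /vspace_of; case: xgetP => [V -> //|/(_ U)].
Qed.

Definition is_span n (U : {vspace 'rV[k]_n}) (X : set 'rV[k]_n) :=
  (forall x, X x -> x \in U) /\
  forall V : {vspace 'rV[k]_n}, (forall x, X x -> x \in V) -> (U <= V)%VS.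

Definition is_filtration n (F : int -> {vspace 'rV[k]_n}) :=
  [/\ forall i j : int, i <= j -> (F j <= F i)%VS,
      forall x, exists i, x \in F i
    & forall x, (forall i, x \in F i) -> x = 0].

Definition fil_type n (F : int -> {vspace 'rV[k]_n}) : seq int :=
  xget [::] [set t : seq int | sorted >=%R t /\ forall i : int,
    count_mem i t = (\dim (F i) - \dim (F (i + 1)%R))%N].

End Filtrations.

Definition in_Zge r (s : seq int) := size s = r /\ sorted >=%R s.

Definition type_le r (s t : seq int) :=
  [/\ in_Zge r s, in_Zge r t,
      forall m, (m <= r)%N -> \sum_(i <- take m s) i <= \sum_(i <- take m t) i
    & \sum_(i <- s) i = \sum_(i <- t) i].

Definition type_cat (s t : seq int) : seq int := sort >=%R (s ++ t).

Section LatticeFiltration.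
Variables (R : comUnitRingType) (u : R) (k : fieldType).
Variables (th : {rmorphism R -> k}) (B : dR_ring u th).

(* F(L1, L2) for L1 the standard lattice, whose reduction L1/uL1 is k^n. *)
Definition lattice_fil_set n (L2 : set 'rV[dr_frac B]_n) (i : int) :
    set 'rV[k]_n :=
  [set v | exists x : 'rV[B]_n, map_mx (dr_res B) x = v /\
     exists y, L2 y /\
       map_mx (dr_to_frac B) x = dr_to_frac B (dr_unif B) ^ i *: y].

Definition lattice_fil n (L2 : set 'rV[dr_frac B]_n) (i : int) :
    {vspace 'rV[k]_n} :=
  vspace_of (lattice_fil_set L2 i).

Lemma lattice_filP n (L2 : set 'rV[dr_frac B]_n) (i : int) :
  L2 0 ->
  (forall (a : B) x y, L2 x -> L2 y -> L2 (dr_to_frac B a *: x + y)) ->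
  forall v, v \in lattice_fil L2 i <-> lattice_fil_set L2 i v.
Proof.
move=> L0 LL; apply: vspace_ofP.
  exists 0; split; first by rewrite map_mx0.
  by exists 0; rewrite scaler0 map_mx0.
move=> c _ _ [x [<- [y [Ly xy]]]] [x' [<- [y' [Ly' xy']]]].
have [a ac] := (dr_resP B).1 c.
exists (a *: x + x'); split; first by rewrite map_mxD map_mxZ ac.
exists (dr_to_frac B a *: y + y'); split; first exact: LL.
by rewrite map_mxD map_mxZ xy xy' scalerDr !scalerA mulrC.
Qed.

End LatticeFiltration.

Section PhiModules.
Variables (RR : realType) (E : local_field RR) (K : perfectoid_ext E).
Variables (Kf : tilt K) (A : ainf Kf) (S : bk_rings A).

Local Notation iR := (bk_to_Rx S).
Local Notation iRphi := (fun x : bk_R S => bk_to_Rx S (bk_phi S x)).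

(* The isomorphism (phi^* M)[1/xi'] -> M[1/xi'] is x |-> x *m pm_phi, the     *)
(* source and the target being the base changes of [M] along [iRphi], [iR].   *)
Record phimod := PhiMod {
  pm_mod :> vectType S;
  pm_phi : 'M[bk_Rx S]_(dim pm_mod);
  pm_phi_unit : pm_phi \in unitmx }.

Implicit Types M N T D : phimod.

Definition is_phimod_hom M N (f : {linear M -> N}) :=
  forall x, bc_lin iR f (x *m pm_phi M) = bc_lin iRphi f x *m pm_phi N.

Definition is_phimod_exact M1 M2 M3 (f : {linear M1 -> M2})
    (g : {linear M2 -> M3}) :=
  [/\ is_phimod_hom f, is_phimod_hom g & short_exact setT setT setT f g].

Definition is_phimod_tensor M N T (b : M -> N -> T) :=
  is_tensor b /\
  forall x y, bc_bilin iRphi b x y *m pm_phi T =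
              bc_bilin iR b (x *m pm_phi M) (y *m pm_phi N).

Definition is_phimod_dual M D (e : D -> M -> S) :=
  is_dual e /\
  forall x y, bc_form iR e (x *m pm_phi D) (y *m pm_phi M) =
              bc_form iRphi e x y.

Definition phi_multilin M T n (s : {ffun 'I_n -> M} -> T) :=
  forall x : {ffun 'I_n -> 'rV[bk_Rx S]_(dim M)},
    bc_multilin iRphi s x *m pm_phi T =
    bc_multilin iR s [ffun j => x j *m pm_phi M].

Definition is_phimod_sym M T n (s : {ffun 'I_n -> M} -> T) :=
  is_sym_power s /\ phi_multilin s.

Definition is_phimod_ext M T n (s : {ffun 'I_n -> M} -> T) :=
  is_ext_power s /\ phi_multilin s.

Definition hodge_fil M : int -> {vspace 'rV[bk_K' S]_(dim M)} :=
  lattice_fil (B := bk_B' S)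
    [set z | exists w : 'rV[bk_B' S]_(dim M),
       z = map_mx (dr_to_frac (bk_B' S)) w *m map_mx (bk_to_BdR' S) (pm_phi M)].

(* In coordinates, psi is x |-> x *m map_mx (bk_to_BdR S) (pm_phi M). *)
Definition hodge_fil_iota M : int -> {vspace 'rV[pe_K K]_(dim M)} :=
  lattice_fil (B := bk_B S)
    [set z | exists w : 'rV[bk_B S]_(dim M),
       z *m map_mx (bk_to_BdR S) (pm_phi M) = map_mx (dr_to_frac (bk_B S)) w].

(* Compatibility of a filtration [F M] on M (x)_R k, for th : R -> k, with    *)
(* morphisms and with the tensor constructions of Fil^Z_k.                    *)
Section Compatibility.
Variables (k : fieldType) (th : {rmorphism S -> k}).
Variable F : forall M, int -> {vspace 'rV[k]_(dim M)}.

Definition fil_functorial :=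
  (forall M, is_filtration (F M)) /\
  forall M N (f : {linear M -> N}), is_phimod_hom f ->
    forall i x, x \in F M i -> bc_lin th f x \in F N i.

Definition fil_compat_tensor :=
  forall M N T (b : M -> N -> T), is_phimod_tensor b ->
    forall i, is_span (F T i)
      [set z | exists i1 i2 x y, [/\ i1 + i2 = i, x \in F M i1, y \in F N i2
                                   & z = bc_bilin th b x y]].

Definition fil_compat_dual :=
  forall M D (e : D -> M -> S), is_phimod_dual e ->
    forall i x, x \in F D i <->
      forall j y, - i < j -> y \in F M j -> bc_form th e x y = 0.

(* The inequality, rather than an equality, gives the unit object for n = 0. *)
Definition fil_power n M T (s : {ffun 'I_n -> M} -> T) :=
  forall i, is_span (F T i)
    [set z | exists (j : {ffun 'I_n -> int})
               (x : {ffun 'I_n -> 'rV[k]_(dim M)}),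
       [/\ i <= \sum_l j l, forall l, x l \in F M (j l)
         & z = bc_multilin th s x]].

Definition fil_compat_sym :=
  forall n M T (s : {ffun 'I_n -> M} -> T), is_phimod_sym s -> fil_power s.

Definition fil_compat_ext :=
  forall n M T (s : {ffun 'I_n -> M} -> T), is_phimod_ext s -> fil_power s.

End Compatibility.

End PhiModules.

(* Main.v *)
(* Over the complete discrete valuation ring B, a pair of lattices has an      *)
(* adapted basis (Smith form): e_i is a basis of L1 and pi^(- a_i) e_i one of   *)
(* L2, so F^i is spanned by the residues of the e_j with a_j >= i.              *)
(*                                                                              *)
(* Frobenius-compatible maps carry lattice pairs to lattice pairs.  The tensor  *)
(* product, and up to the unit n! also the symmetric and exterior powers, are   *)
(* retracts of Kronecker products of lattice pairs, for which adapted bases     *)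
(* are tensor products of adapted bases; the dual is the inverse transpose.     *)
(*                                                                              *)
(* For an exact sequence put Lambda_c = L1 + pi^c L2, whose determinant has     *)
(* valuation sum_j min(0, c - a_j).  Lambda_c(M2) surjects onto Lambda_c(M3)    *)
(* and meets M1 in a lattice containing Lambda_c(M1); comparing determinants    *)
(* yields the inequality of types.  In case of equality Lambda_c(M2) meets M1   *)
(* exactly in Lambda_c(M1) for all c, whence F^i(M2) meets the reduction of M1  *)
(* in F^i(M1), and counting dimensions gives exactness.                         *)

Require Import Defs.
From HB Require Import structures.
From mathcomp Require Import all_boot all_order perm all_algebra fieldext.
From mathcomp Require Import boolp classical_sets reals.
From mathcomp Require Import zify.

Set Implicit Arguments.
Unset Strict Implicit.
Unset Printing Implicit Defensive.

Import Order.TTheory GRing.Theory Num.Theory.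

Local Open Scope classical_set_scope.
Local Open Scope ring_scope.

(** * Valuation theory of the completed local ring *)

(** Both Hodge filtrations are instances of [lfil Q], attached to the standard lattice over a
    complete discrete valuation ring [B] and the lattice spanned by the rows of an invertible matrix
    [Q] over its fraction field. For [hodge_fil], [Q] is the image of the Frobenius matrix; for
    [hodge_fil_iota], it is the inverse of that image. [hodge_propertiesP] derives all the claims
    from the compatibility of [Q] with structure maps, which [hodge_properties_source] and
    [hodge_properties_target] verify. That the uniformizer is nonzero comes from [ai_xi_neq0] and
    [dr_unif_neq0].

    The Smith form ([adapted_exists]) makes [lfil Q] explicit: by [adapted_lfil] it is split by a
    basis of the residue space, with the weights as jumps. Tensor products and powers of adapted
    bases are adapted ([adapted_kron], [adapted_tpow]). [lfil_retract_span] carries the resulting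
    description to any module satisfying the universal property, where for symmetric and exterior
    powers the retraction costs a factor [n!], a unit by [bk_natr_unit]. Duals are handled by dual
    bases ([lfil_dualP]).

    For exact sequences, the sums of the standard lattice and [tau ^ c] times the second one have
    determinants whose valuations are truncated sums of weights. Comparing them ([thick_le],
    [sum_weights]) and recovering partial sums from truncated sums ([type_le_sort]) gives the
    inequality. In case of equality these lattices form exact sequences ([split_sequence_sub]), so
    the filtration on the submodule is the induced one ([thick_eq_lfil]), and a dimension count
    finishes ([lfil_exactP]). *)

Section CompletedLocalRing.
Variables (R : comUnitRingType) (u : R) (k : fieldType) (th : {rmorphism R ->
  k}).
Variable B : dR_ring u th.
Hypothesis unif_neq0 : dr_unif B != 0.

Local Notation L := (dr_frac B).
Local Notation iL := (dr_to_frac B).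
Local Notation pi := (dr_unif B).
Local Notation res := (dr_res B).
Local Notation tau := (dr_to_frac B (dr_unif B)).

Lemma dr_to_frac_eq0 x : iL x = 0 -> x = 0.
Proof.
move=> x0; apply/eqP; apply: contrapT => /negP xN0.
by have [+ _ _] := dr_fracP B; move=> /(_ x xN0); rewrite x0 unitr0.
Qed.

Lemma dr_to_frac_inj : injective iL.
Proof.
by move=> x y xy; apply/subr0_eq/dr_to_frac_eq0; rewrite rmorphB xy subrr.
Qed.

Lemma dr_res_unif : res pi = 0.
Proof. by apply/(dr_resP B).2; exists 1; rewrite mulr1. Qed.

Lemma dr_frac_unif_neq0 : tau != 0.
Proof.
by apply/eqP => /dr_to_frac_eq0 /eqP; apply/negP.
Qed.

(** Geometric series: [b * b0 = 1 - pi * c] when [b0] lifts the inverse residue, the sums of powers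
    of [pi * c] converge by completeness, and separatedness shows that the limit inverts
    [b * b0]. *)
Lemma dr_res_unit (b : B) : res b != 0 -> exists b', b * b' = 1.
Proof.
move=> rb; have [b0 rb0] := (dr_resP B).1 (res b)^-1.
have /(dr_resP B).2 [c bc] : res (1 - b * b0) = 0.
  by rewrite rmorphB rmorphM rmorph1 rb0 divff // subrr.
have [[sep cau] _ _] := dr_complP B.
pose s n := \sum_(i < n) (pi * c) ^+ i.
have [n|l sl] := cau s.
  by exists (c ^+ n); rewrite /s big_ord_recr /= addrAC subrr add0r exprMn.
exists (b0 * l); rewrite mulrA; apply/subr0_eq/sep => n.
have [d ld] := sl n; have bE : b * b0 = 1 - pi * c by rewrite -bc subKr.
have sE : b * b0 * s n = 1 - (pi * c) ^+ n.
  by rewrite bE -[1 - pi * c]opprB mulNr -subrX1 opprB.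
exists (b * b0 * d - c ^+ n).
rewrite mulrBr mulrCA -[dr_compl B _]/pi -exprMn -[_ ^+ n * d]ld mulrBr sE.
by rewrite -addrA -opprD subrK.
Qed.

Lemma dr_unit_res (b b' : B) : b * b' = 1 -> res b != 0.
Proof.
move=> bb; apply/eqP => rb; have := congr1 res bb.
by rewrite rmorphM rb mul0r rmorph1 => /esym/eqP; rewrite oner_eq0.
Qed.

(** By separatedness some power of [pi] does not divide [b]; the exponent sought is one less than
    the least such. *)
Lemma dr_factor (b : B) : b != 0 -> exists n c, b = pi ^+ n * c /\ res c != 0.
Proof.
move=> bN0; pose Q n := `[< ~ exists c, b = pi ^+ n * c >].
have exQ : exists n, Q n.
  apply: contrapT => nQ; have [[sep _] _ _] := dr_complP B.
  move/eqP: bN0; apply; apply: sep => n; apply: contrapT => nc.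
  by apply: nQ; exists n; apply/asboolP.
case: (ex_minnP exQ) => -[|n] /asboolP nc minn.
  by case: nc; exists b; rewrite expr0 mul1r.
have /asboolP/contrapT [c bc] : ~~ Q n by apply/negP => /minn; rewrite ltnn.
exists n, c; split=> //; apply/eqP => /(dr_resP B).2 [d cd].
by apply: nc; exists d; rewrite bc cd exprSr mulrA.
Qed.

(** The valuation as a relation, so that for determinants it can be carried along as an explicit
    integer expression. *)
Definition dr_isval (x : L) (n : int) :=
  exists b b', b * b' = 1 /\ x = tau ^ n * iL b.

Lemma dr_isval_ex x : x != 0 -> exists n, dr_isval x n.
Proof.
move=> xN0; have [_ /(_ x) [a [s [sN0 xE]]] _] := dr_fracP B.
have aN0 : a != 0.
  by apply: contraNneq xN0 => a0; rewrite xE a0 rmorph0 mul0r.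
have [n [c [ac rc]]] := dr_factor aN0.
have [m [d [sd rd]]] := dr_factor sN0.
have [c' cc'] := dr_res_unit rc; have [d' dd'] := dr_res_unit rd.
exists (n%:Z - m%:Z), (c * d'), (c' * d); split.
  by rewrite mulrACA cc' mul1r mulrC.
have dinv : (iL d)^-1 = iL d'.
  apply: (@mulfI _ (iL d)); first by apply/eqP => /dr_to_frac_eq0 d0;
    move: rd; rewrite d0 rmorph0 eqxx.
  rewrite -rmorphM dd' rmorph1 divff //.
  by apply/eqP => /dr_to_frac_eq0 d0; move: rd; rewrite d0 rmorph0 eqxx.
rewrite xE ac sd !rmorphM !rmorphXn invfM dinv mulrACA.
by rewrite expfzDr ?dr_frac_unif_neq0 // -exprnP exprnN.
Qed.

Lemma dr_intP (n : int) (b : B) :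
  res b != 0 -> (exists c, tau ^ n * iL b = iL c) <-> 0 <= n.
Proof.
move=> rb; split=> [[c]|]; last first.
  by case: n => // n _; exists (pi ^+ n * b); rewrite rmorphM rmorphXn.
case: n => // n bc; have : b = pi ^+ n.+1 * c.
  apply: dr_to_frac_inj; rewrite rmorphM rmorphXn -bc mulrA NegzE exprnP.
  by rewrite -expfzDr ?dr_frac_unif_neq0 // subrr expr0z mul1r.
by move=> bE; move: rb; rewrite bE rmorphM rmorphXn dr_res_unif exprS !mul0r
  eqxx.
Qed.

(** Functional form, for choosing pivots; at [0] it takes the dummy value [0]. *)
Definition dr_val (x : L) : int := xget 0 [set n | dr_isval x n].

Lemma dr_valP x : x != 0 -> dr_isval x (dr_val x).
Proof.
by move=> /dr_isval_ex [n xn]; rewrite /dr_val; apply: (@xgetPex _ 0 (dr_isval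
  x)); exists n.
Qed.

Lemma dr_val_dvd x y : y != 0 -> x != 0 -> dr_val x <= dr_val y ->
  exists c, y = x * iL c.
Proof.
move=> yN0 xN0 xy.
have [b [b' [bb']]] := dr_valP xN0; have [d [d' [dd']]] := dr_valP yN0.
move: (dr_val x) (dr_val y) xy => m n mn yE xE.
have : res (d * b') != 0.
  by apply: (@dr_unit_res _ (d' * b)); rewrite mulrACA dd' mul1r mulrC.
move=> /(dr_intP (n - m)) [_].
rewrite subr_ge0 => /(_ mn) [c cE]; exists c; rewrite xE -cE yE.
rewrite mulrACA -expfzDr ?dr_frac_unif_neq0 // addrC subrK; congr (_ * _).
by rewrite -rmorphM mulrCA bb' mulr1.
Qed.

End CompletedLocalRing.
(** * Prefix sums and truncated sums *)

Lemma sum_min_take (s : seq int) c m :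
  \sum_(x <- s) Num.min 0 (c - x) <= \sum_(x <- take m s) Num.min 0 (c - x).
Proof.
rewrite -{1}(cat_take_drop m s) big_cat /= gerDl; apply: sumr_le0 => x _.
by lia.
Qed.

(** Term by term, since [c - Num.min 0 (c - x)] is the maximum of [c] and [x]. *)
Lemma sum_le_min (q : seq int) c :
  \sum_(x <- q) x <= c *+ size q - \sum_(x <- q) Num.min 0 (c - x).
Proof.
elim: q => [|x q IHq]; first by rewrite !big_nil.
rewrite !big_cons /= mulrS; move: (\sum_(x <- q) x) (\sum_(x <- q) _) IHq.
by move: (c *+ _) => *; lia.
Qed.

Lemma sum_eq_min (q : seq int) c : all (>= c) q ->
  \sum_(x <- q) x = c *+ size q - \sum_(x <- q) Num.min 0 (c - x).
Proof.
elim: q => [|x q IHq]; first by rewrite !big_nil.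
rewrite !big_cons /= mulrS => /andP[cx /IHq ->].
by move: (\sum_(x <- q) _) (c *+ _) => *; lia.
Qed.

Lemma sum_take_le (s : seq int) c m : (m <= size s)%N ->
  \sum_(x <- take m s) x <= c *+ m - \sum_(x <- s) Num.min 0 (c - x).
Proof.
move=> ms; have := sum_le_min (take m s) c; rewrite size_takel //.
have := sum_min_take s c m.
by move: (\sum_(x <- take m s) x) (\sum_(x <- _) _) (\sum_(x <- _) _) (c *+ m)
  => *; lia.
Qed.

(** For [c] the last entry of the prefix, the entries kept are at least [c] and those dropped at
    most [c], so the bound of [sum_take_le] is attained. *)
Lemma sum_take_sorted (t : seq int) m : (m < size t)%N -> sorted >=%R t ->
  \sum_(x <- take m.+1 t) x =
  nth 0 t m *+ m.+1 - \sum_(x <- t) Num.min 0 (nth 0 t m - x).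
Proof.
move=> mt st; set c := nth 0 t m.
have tj i j : (i <= j < size t)%N -> nth 0 t j <= nth 0 t i.
  move=> /andP[ij jt]; have := @sorted_leq_nth _ _ ge_trans lexx 0 t st i j.
  by rewrite !inE; apply=> //; apply: leq_ltn_trans jt.
rewrite (@sum_eq_min _ c) ?size_takel //; last first.
  apply/(all_nthP 0) => i; rewrite size_takel // => im.
  by rewrite nth_take //; apply: tj; rewrite -ltnS im.
congr (_ - _); rewrite -{2}(cat_take_drop m.+1 t) big_cat /=.
rewrite [X in _ + X]big1_seq ?addr0 // => x /andP[_ /(nthP 0) [i]].
rewrite size_drop => it <-; rewrite nth_drop; apply/min_idPl.
rewrite subr_ge0; apply: tj; rewrite addSn -addnS leq_addr /=.
by rewrite addnS -addSn -ltn_subRL.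
Qed.

(* Sums of truncations [min 0 (c - x)] determine the partial sums: for sorted *)
(* [t], take [c] to be the last entry of the partial sum.                     *)
Lemma type_le_sort r (s t : seq int) : size s = r -> size t = r ->
  \sum_(x <- s) x = \sum_(x <- t) x ->
  (forall c : int, \sum_(x <- t) Num.min 0 (c - x) <= \sum_(x <- s) Num.min 0
    (c - x)) ->
  type_le r (sort >=%R s) (sort >=%R t).
Proof.
move=> sr tr st le_ts; have sS q : sorted >=%R (sort >=%R q : seq int).
  exact/sort_sorted/ge_total.
split; rewrite /in_Zge ?size_sort ?sS //; last first.
  by rewrite !(perm_big _ (permEl (perm_sort _ _))).
move=> [|m] mr; first by rewrite !take0.
rewrite [leRHS]sum_take_sorted ?size_sort ?tr //.
set c := nth 0 _ m; have := @sum_take_le (sort >=%R s) c m.+1.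
rewrite size_sort sr => /(_ mr) /le_trans; apply.
by rewrite lerD2l lerN2 !(perm_big _ (permEl (perm_sort _ _))) le_ts.
Qed.
(** * Tensor powers of matrices *)

Section FinIndexedMatrices.
Variables (I : finType) (R : comNzRingType).

(** Numbering a finite type by [enum_val] lets tensor bases keep their natural labels: pairs of
    indices, or index functions. *)
Definition fmx (q : I -> I -> R) : 'M[R]_#|I| :=
  \matrix_(a, b) q (enum_val a) (enum_val b).

Definition frow (c : I -> R) : 'rV[R]_#|I| := \row_a c (enum_val a).

Definition fstack n (s : I -> 'rV[R]_n) : 'M[R]_(#|I|, n) :=
  \matrix_a s (enum_val a).

Lemma sum_enum_val (V : nmodType) (F : I -> V) :
  \sum_(a < #|I|) F (enum_val a) = \sum_x F x.
Proof.
rewrite [RHS](reindex (@enum_val I I)) //=.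
exact/onW_bij/enum_val_bij.
Qed.

Lemma fmxM q r : fmx q *m fmx r = fmx (fun x y => \sum_z q x z * r z y).
Proof.
apply/matrixP => a b; rewrite !mxE -sum_enum_val.
by apply: eq_bigr => c _; rewrite !mxE.
Qed.

Lemma frow_fmx c q : frow c *m fmx q = frow (fun y => \sum_z c z * q z y).
Proof.
apply/rowP => b; rewrite !mxE -sum_enum_val.
by apply: eq_bigr => a _; rewrite !mxE.
Qed.

Lemma frow_fstack n c (s : I -> 'rV[R]_n) :
  frow c *m fstack s = \sum_x c x *: s x.
Proof.
rewrite mulmx_sum_row -sum_enum_val; apply: eq_bigr => a _.
by rewrite rowK mxE.
Qed.

Lemma fmx1 : fmx (fun x y => (x == y)%:R) = 1%:M.
Proof. by apply/matrixP => a b; rewrite !mxE (inj_eq enum_val_inj). Qed.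

Lemma eq_fmx q r : q =2 r -> fmx q = fmx r.
Proof. by move=> qr; apply/matrixP => a b; rewrite !mxE qr. Qed.

Lemma eq_frow c d : c =1 d -> frow c = frow d.
Proof. by move=> cd; apply/rowP => a; rewrite !mxE cd. Qed.

Lemma row_fmx q a : row a (fmx q) = frow (q (enum_val a)).
Proof. by apply/rowP => b; rewrite !mxE. Qed.

End FinIndexedMatrices.

Section TensorMatrices.
Variable R : comNzRingType.

Definition kron m n (P : 'M[R]_m) (P' : 'M[R]_n) :=
  fmx (fun x y : 'I_m * 'I_n => P x.1 y.1 * P' x.2 y.2).

Definition krow m n (x : 'rV[R]_m) (y : 'rV[R]_n) :=
  frow (fun h : 'I_m * 'I_n => x 0 h.1 * y 0 h.2).

Definition tpow n m (P : 'M[R]_m) :=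
  fmx (fun x y : {ffun 'I_n -> 'I_m} => \prod_j P (x j) (y j)).

Definition trow n m (x : 'I_n -> 'rV[R]_m) :=
  frow (fun h : {ffun 'I_n -> 'I_m} => \prod_j x j 0 (h j)).

Lemma kronM m n (P S : 'M[R]_m) (P' S' : 'M[R]_n) :
  kron P P' *m kron S S' = kron (P *m S) (P' *m S').
Proof.
rewrite fmxM; apply: eq_fmx => x y; rewrite !mxE big_distrlr pair_bigA /=.
by apply: eq_bigr => z _; rewrite mulrACA.
Qed.

Lemma krow_kron m n (x : 'rV[R]_m) (y : 'rV[R]_n) P P' :
  krow x y *m kron P P' = krow (x *m P) (y *m P').
Proof.
rewrite frow_fmx; apply: eq_frow => h; rewrite !mxE big_distrlr pair_bigA /=.
by apply: eq_bigr => z _; rewrite mulrACA.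
Qed.

Lemma kron1 m n : kron (1%:M : 'M[R]_m) (1%:M : 'M[R]_n) = 1%:M.
Proof.
rewrite -fmx1; apply: eq_fmx => -[x x'] [y y']; rewrite !mxE xpair_eqE /=.
by rewrite -natrM mulnb.
Qed.

Lemma tpowM n m (P S : 'M[R]_m) : tpow n P *m tpow n S = tpow n (P *m S).
Proof.
rewrite fmxM; apply: eq_fmx => x y.
transitivity (\prod_j \sum_z P (x j) z * S z (y j)).
  by rewrite bigA_distr_bigA; apply: eq_bigr => z _; rewrite big_split.
by apply: eq_bigr => j _; rewrite mxE.
Qed.

Lemma trow_tpow n m (x : 'I_n -> 'rV[R]_m) P :
  trow x *m tpow n P = trow (fun j => x j *m P).
Proof.
rewrite frow_fmx; apply: eq_frow => h.
transitivity (\prod_j \sum_z x j 0 z * P z (h j)).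
  by rewrite bigA_distr_bigA; apply: eq_bigr => z _; rewrite big_split.
by apply: eq_bigr => j _; rewrite mxE.
Qed.

Lemma prod_nat_eq n m (x y : {ffun 'I_n -> 'I_m}) :
  \prod_j (x j == y j)%:R = (x == y)%:R :> R.
Proof.
have [->|xy] := eqVneq x y; first by rewrite big1 // => j _; rewrite eqxx.
have [j xyj] : exists j, x j != y j.
  by apply/existsP; apply: contraNT xy => /existsPn xy; apply/eqP/ffunP => j;
    apply/eqP; rewrite -[_ == _]negbK xy.
by rewrite (bigD1 j) //= (negPf xyj) mul0r.
Qed.

Lemma tpow1 n m : tpow n (1%:M : 'M[R]_m) = 1%:M.
Proof.
rewrite -fmx1; apply: eq_fmx => x y; rewrite -prod_nat_eq.
by apply: eq_bigr => j _; rewrite mxE.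
Qed.

Definition tperm_pow n m (w : {perm 'I_n}) :=
  fmx (fun x y : {ffun 'I_n -> 'I_m} => ([ffun j => x (w j)] == y)%:R : R).

(** Each entry of either product has a single nonzero term, and the two terms differ by a reindexing
    of the product over [j]. *)
Lemma tperm_powC n m (w : {perm 'I_n}) (P : 'M[R]_m) :
  tperm_pow m w *m tpow n P = tpow n P *m tperm_pow m w.
Proof.
rewrite !fmxM; apply: eq_fmx => x y.
rewrite (bigD1 [ffun j => x (w j)]) //= eqxx mul1r [X in _ + X]big1 ?addr0;
  last first.
  by move=> z; rewrite eq_sym => /negPf ->; rewrite mul0r.
rewrite [RHS](bigD1 [ffun j => y ((w^-1)%g j)]) //= [X in _ + X]big1 ?addr0;
  last first.
  move=> z zy; case: eqP => [yE|_]; last by rewrite mulr0.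
  by case/eqP: zy; apply/ffunP => j; rewrite -yE !ffunE permKV.
rewrite (_ : [ffun j => _] == y); last first.
  by apply/eqP/ffunP => j; rewrite !ffunE permK.
rewrite mulr1 (reindex_inj (@perm_inj _ (w^-1)%g)) /=.
by apply: eq_bigr => j _; rewrite !ffunE permKV.
Qed.

End TensorMatrices.

Section MapTensorMatrices.
Variables (R S : comNzRingType) (h : {rmorphism R -> S}).

Lemma map_fmx (I : finType) (q : I -> I -> R) :
  map_mx h (fmx q) = fmx (fun x y => h (q x y)).
Proof. by apply/matrixP => a b; rewrite !mxE. Qed.

Lemma map_kron m n (P : 'M[R]_m) (P' : 'M[R]_n) :
  map_mx h (kron P P') = kron (map_mx h P) (map_mx h P').
Proof. by rewrite map_fmx; apply: eq_fmx => x y; rewrite rmorphM !mxE. Qed.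

Lemma map_tpow n m (P : 'M[R]_m) : map_mx h (tpow n P) = tpow n (map_mx h P).
Proof.
rewrite map_fmx; apply: eq_fmx => x y; rewrite rmorph_prod.
by apply: eq_bigr => j _; rewrite mxE.
Qed.

Lemma map_tperm_pow n m (w : {perm 'I_n}) :
  map_mx h (tperm_pow R m w) = tperm_pow S m w.
Proof. by rewrite map_fmx; apply: eq_fmx => x y; rewrite rmorph_nat. Qed.

End MapTensorMatrices.
(** * Filtrations defined by pairs of lattices *)

Section Lattices.
Variables (R : comUnitRingType) (u : R) (k : fieldType) (th : {rmorphism R ->
  k}).
Variable B : dR_ring u th.
Hypothesis unif_neq0 : dr_unif B != 0.

Local Notation L := (dr_frac B).
Local Notation iL := (dr_to_frac B).
Local Notation pi := (dr_unif B).
Local Notation res := (dr_res B).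
Local Notation tau := (dr_to_frac B (dr_unif B)).

Definition tau_mx n (a : 'rV[int]_n) : 'M[L]_n :=
  diag_mx (map_mx (exprz tau) a).

(* Smith form of [Q], i.e. a basis [U] of the standard lattice such that the *)
(* rows of [diag (tau ^ (- a)) U] are a basis of the lattice spanned by the  *)
(* rows of [Q]; the weights [a] are then the jumps of the filtration.        *)
Definition adapted n (Q : 'M[L]_n) (a : 'rV[int]_n) (U U' : 'M[B]_n) :=
  U *m U' = 1%:M /\ exists V V' : 'M[B]_n, V *m V' = 1%:M /\
    Q = map_mx iL V *m tau_mx (- a) *m map_mx iL U.

Lemma adapted_mull n (Q : 'M[L]_n) a U U' (W W' : 'M[B]_n) :
  W *m W' = 1%:M -> adapted Q a U U' -> adapted (map_mx iL W *m Q) a U U'.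
Proof.
move=> WW [UU [V [V' [VV ->]]]]; split=> //; exists (W *m V), (V' *m W').
by rewrite mulmxA -(mulmxA W) VV mulmx1 WW map_mxM !mulmxA.
Qed.

Lemma adapted_mulr n (Q : 'M[L]_n) a U U' (W W' : 'M[B]_n) :
  W *m W' = 1%:M -> adapted Q a U U' ->
  adapted (Q *m map_mx iL W) a (U *m W) (W' *m U').
Proof.
move=> WW [UU [V [V' [VV ->]]]]; split.
  by rewrite mulmxA -(mulmxA U) WW mulmx1.
by exists V, V'; rewrite map_mxM !mulmxA.
Qed.

(** If [x] is a unit times [tau ^ d], its weight is [- d], because the Smith form uses the exponents
    [- a]. *)
Lemma adapted_block n (x : L) (S : 'M[L]_n) a U U' : x != 0 -> adapted S a U U'
  ->
  exists a1 U1 U1', adapted (block_mx x%:M 0 0 S : 'M_(1 + n)) a1 U1 U1'.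
Proof.
move=> xN0 [UU [V [V' [VV SE]]]].
have [d [b [b' [bb xE]]]] := dr_isval_ex unif_neq0 xN0.
exists (row_mx (- d)%:M a), (block_mx 1%:M 0 0 U), (block_mx 1%:M 0 0 U').
split.
  by rewrite mulmx_block !(mulmx0, mul0mx, addr0, add0r, mulmx1) UU
    scalar_mx_block.
exists (block_mx b%:M 0 0 V), (block_mx b'%:M 0 0 V'); split.
  rewrite mulmx_block !(mulmx0, mul0mx, addr0, add0r) VV -scalar_mxM bb.
  by rewrite scalar_mx_block.
rewrite /tau_mx opp_row_mx map_row_mx diag_mx_row !map_block_mx !map_mx0.
rewrite !map_mx1 !mulmx_block !(mulmx0, mul0mx, addr0, add0r, mulmx1).
congr block_mx; last by rewrite SE.
apply/matrixP => i j; rewrite !ord1 mxE eqxx mulr1n xE mxE big_ord1.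
by rewrite !mxE eqxx !mulr1n opprK mulrC.
Qed.

(** Elimination: the corner entry divides all others, so unipotent matrices over [B] clear its row
    and column. *)
Lemma adapted_pivot n (Q : 'M[L]_(1 + n)) : Q 0 0 != 0 ->
  (forall i j, exists c, Q i j = Q 0 0 * iL c) ->
  exists (l r : 'M[B]_(1 + n)) (S : 'M[L]_n),
    [/\ \det l = 1, \det r = 1
      & Q = map_mx iL l *m block_mx (Q 0 0)%:M 0 0 S *m map_mx iL r].
Proof.
move=> q0 dvdQ.
have /boolp.choice [c cE] : forall p : 'I_(1 + n) * 'I_(1 + n),
    exists c, Q p.1 p.2 = Q 0 0 * iL c by move=> p; exact: dvdQ.
pose cl : 'M[B]_(n, 1) := \matrix_(i, j) c (rshift 1 i, 0).
pose rw : 'M[B]_(1, n) := \matrix_(i, j) c (0, rshift 1 j).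
pose Q' : 'M[L]_(1 + n) := Q.
exists (block_mx 1%:M 0 cl 1%:M), (block_mx 1%:M rw 0 1%:M).
exists (drsubmx Q' - Q 0 0 *: (map_mx iL cl *m map_mx iL rw)).
rewrite det_lblock det_ublock !det1 !mulr1; split=> //.
rewrite !map_block_mx !map_mx0 !map_mx1 !mulmx_block.
rewrite !(mulmx0, mul0mx, addr0, add0r, mulmx1, mul1mx).
rewrite mul_scalar_mx mul_mx_scalar -scalemxAl addrC subrK.
rewrite -[LHS](submxK Q'); congr block_mx.
- by apply/matrixP => i j; rewrite !ord1 !mxE !lshift0 eqxx.
- by apply/matrixP => i j; rewrite ord1 !mxE lshift0 -cE.
- by apply/matrixP => i j; rewrite [j]ord1 !mxE lshift0 -cE.
Qed.

Lemma det1_inv n (W : 'M[B]_n) : \det W = 1 -> W *m \adj W = 1%:M.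
Proof. by rewrite mul_mx_adj => ->. Qed.

(** Induction on the size: transpositions bring an entry of least valuation to the corner, where it
    divides every entry by [dr_val_dvd] and can be split off. *)
Lemma adapted_exists n (Q : 'M[L]_n) : Q \in unitmx ->
  exists a U U', adapted Q a U U'.
Proof.
elim: n Q => [|n IHn] Q Qu.
  exists 0, 1%:M, 1%:M; split; first by rewrite mulmx1.
  exists 1%:M, 1%:M; split; first by rewrite mulmx1.
  by rewrite [Q]thinmx0 [RHS]thinmx0.
have /existsP [p0 p0N] : [exists p : 'I_n.+1 * 'I_n.+1, Q p.1 p.2 != 0].
  apply: contraLR Qu => /existsPn Q0; rewrite unitmxE (_ : Q = 0) ?det0 ?unitr0
    //.
  by apply/matrixP => i j; have := Q0 (i, j); rewrite negbK mxE => /eqP.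
pose f (p : 'I_n.+1 * 'I_n.+1) := dr_val (B := B) (Q p.1 p.2).
have [[i j] ijN minij] := arg_minP (P := fun p => Q p.1 p.2 != 0) f p0N.
pose W m : 'M[B]_n.+1 := tperm_mx m 0.
have WW m : W m *m W m = 1%:M.
  by rewrite /W /tperm_mx -perm_mxM tperm2 perm_mx1.
have WLW m : map_mx iL (W m) *m map_mx iL (W m) = 1%:M.
  by rewrite -map_mxM WW map_mx1.
pose Q1 := map_mx iL (W i) *m Q *m map_mx iL (W j).
have Q1E x y : Q1 x y = Q (tperm i 0 x) (tperm j 0 y).
  rewrite /Q1 /W /tperm_mx !map_perm_mx -[tperm j 0]tpermV -col_permE
    -row_permE.
  by rewrite !mxE ?tpermV.
suff [a [U [U' aQ]]] : exists a U U', adapted Q1 a U U'.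
  exists a, (U *m W j), (W j *m U').
  rewrite (_ : Q = map_mx iL (W i) *m Q1 *m map_mx iL (W j)).
    apply: adapted_mulr => //; exact: adapted_mull.
  by rewrite /Q1 !mulmxA WLW mul1mx -mulmxA WLW mulmx1.
have Q1u : Q1 \in unitmx.
  have Wu m : map_mx iL (W m) \in unitmx by case: (mulmx1_unit (WLW m)).
  by rewrite !unitmx_mul !Wu Qu.
have q0 : Q1 0 0 != 0 by rewrite Q1E !tpermR.
have [x y|l [r [S [l1 r1 E]]]] := adapted_pivot q0.
  rewrite !Q1E !tpermR; set q := Q _ _; have [->|qN] := eqVneq q 0.
    by exists 0; rewrite rmorph0 mulr0.
  apply: dr_val_dvd => //; exact: (minij (_, _)).
have Su : S \in unitmx.
  have := Q1u; rewrite unitmxE E !det_mulmx !det_map_mx l1 r1 rmorph1 mul1r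
    mulr1.
  rewrite (@det_ublock _ 1 n) !unitfE mulf_eq0 negb_or => /andP[_ dS].
  by rewrite unitmxE unitfE.
have [a [U [U' aS]]] := IHn _ Su.
have [a1 [U1 [U1' aS1]]] := adapted_block q0 aS.
exists a1, (U1 *m r), (\adj r *m U1'); rewrite E.
by apply: adapted_mulr (det1_inv r1) _; apply: adapted_mull (det1_inv l1) _.
Qed.

Definition lat n (Q : 'M[L]_n) : set 'rV[L]_n :=
  [set z | exists w : 'rV[B]_n, z = map_mx iL w *m Q].

Definition lfil n (Q : 'M[L]_n) (i : int) : {vspace 'rV[k]_n} :=
  lattice_fil (B := B) (lat Q) i.

Lemma lfilP n (Q : 'M[L]_n) i v : v \in lfil Q i <->
  exists x w, map_mx res x = v /\ map_mx iL x = tau ^ i *: (map_mx iL w *m Q).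
Proof.
apply: iff_trans (lattice_filP _ _ _ _) _.
- by exists 0; rewrite map_mx0 mul0mx.
- move=> a _ _ [w ->] [w' ->]; exists (a *: w + w').
  by rewrite map_mxD map_mxZ mulmxDl scalemxAl.
- split=> [[x [xv [_ [[w ->] xE]]]]|[x [w [xv xE]]]]; first by exists x, w.
  by exists x; split=> //; exists (map_mx iL w *m Q); split=> //; exists w.
Qed.

(** The hypothesis makes [f0], [f1] a morphism of lattice pairs: [f0] acts on the standard lattices,
    [f1] on coordinates with respect to the rows of [P] and [Q]. *)
Lemma lfil_mor m n (P : 'M[L]_m) (Q : 'M[L]_n) (f0 f1 : 'M[B]_(m, n)) i v :
  P *m map_mx iL f0 = map_mx iL f1 *m Q ->
  v \in lfil P i -> v *m map_mx res f0 \in lfil Q i.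
Proof.
move=> PQ /lfilP [x [w [<- xE]]]; apply/lfilP; exists (x *m f0), (w *m f1).
by rewrite !map_mxM xE -scalemxAl -!mulmxA PQ.
Qed.

(** * The filtration and its jumps in an adapted basis *)

Section Adapted.
Variables (n : nat) (Q : 'M[L]_n) (a : 'rV[int]_n) (U U' : 'M[B]_n).
Hypothesis aQ : adapted Q a U U'.

Let UU : U *m U' = 1%:M. Proof. by case: aQ. Qed.
Let UU' : U' *m U = 1%:M. Proof. exact: mulmx1C. Qed.

(** For a vector of the standard lattice lying in [tau ^ i] times the second one, coordinate [j] in
    the basis [U] is divisible by [tau ^ (i - a 0 j)], so its residue vanishes when [a 0 j < i]. The
    other coordinates are unconstrained. *)
Lemma adapted_lfil i v :
  v \in lfil Q i <-> forall j, (v *m map_mx res U') 0 j != 0 -> i <= a 0 j.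
Proof.
have [_ [V [V' [VV QE]]]] := aQ; split.
  move=> /lfilP [x [w [<- xE]]] j; apply: contra_neqT; rewrite -ltNge => aji.
  have : iL ((x *m U') 0 j) = tau ^ (i - a 0 j) * iL ((w *m V) 0 j).
    transitivity (map_mx iL (x *m U') 0 j); first by rewrite [RHS]mxE.
    rewrite map_mxM xE QE -scalemxAl !mulmxA -[_ *m _ *m map_mx _ U']mulmxA.
    rewrite -(map_mxM _ U) UU map_mx1 mulmx1 -map_mxM /tau_mx mul_mx_diag !mxE.
    by rewrite mulrCA -expfzDr ?dr_frac_unif_neq0 // mulrC.
  have [m ->] : exists m : nat, i - a 0 j = m.+1%:Z.
    by exists (absz (i - a 0 j)%R).-1; lia.
  rewrite -exprnP -rmorphXn -rmorphM => /dr_to_frac_inj E.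
  by rewrite -map_mxM mxE E rmorphM rmorphXn dr_res_unif exprS !mul0r.
move=> vU; apply/lfilP.
(* [b.1] lifts the residue coordinate and [b.2] is its coordinate in the second lattice; a zero
   coordinate is lifted by zero, as [a 0 j] may then be less than [i]. *)
have /boolp.choice [b bE] : forall j, exists b : B * B,
    res b.1 = (v *m map_mx res U') 0 j /\
    iL b.1 = tau ^ (i - a 0 j) * iL b.2.
  move=> j; have [->|cN] := eqVneq ((v *m map_mx res U') 0 j) 0.
    by exists (0, 0); rewrite /= !rmorph0 mulr0.
  have [c cE] := (dr_resP B).1 ((v *m map_mx res U') 0 j).
  have := vU j cN; set d := a 0 j - i => le_ia.
  have [m mE] : exists m : nat, d = m by exists (absz d); rewrite /d; lia.
  exists (c, pi ^+ m * c); rewrite cE; split=> //=.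
  rewrite rmorphM rmorphXn exprnP -mE mulrA -expfzDr ?dr_frac_unif_neq0 //.
  by rewrite /d addrA subrK subrr expr0z mul1r.
pose x := \row_j (b j).1; pose y := \row_j (b j).2.
exists (x *m U), (y *m V'); split.
  have -> : v = v *m map_mx res U' *m map_mx res U.
    by rewrite -mulmxA -map_mxM UU' map_mx1 mulmx1.
  rewrite map_mxM; congr (_ *m _); apply/rowP => j.
  by rewrite mxE (mxE _ _ _ j) (bE j).1.
rewrite !map_mxM QE !mulmxA -(mulmxA (map_mx iL y)) -(map_mxM _ V') (mulmx1C
  VV) map_mx1.
rewrite mulmx1 scalemxAl; congr (_ *m _); apply/rowP => j.
rewrite [LHS]mxE mxE (bE j).2 mxE /tau_mx mul_mx_diag !mxE.
by rewrite expfzDr ?dr_frac_unif_neq0 // mulrCA mulrC mulrA.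
Qed.

Lemma adapted_row_lfil i j : row j (map_mx res U) \in lfil Q i = (i <= a 0 j).
Proof.
have E l : (row j (map_mx res U) *m map_mx res U') 0 l = (j == l)%:R.
  by rewrite -row_mul -map_mxM UU map_mx1 !mxE.
apply/idP/idP => [/adapted_lfil/(_ j)|ij]; first by rewrite E eqxx oner_eq0;
  apply.
by apply/adapted_lfil => l; rewrite E; case: (j =P l) => [<- //|_]; rewrite
  eqxx.
Qed.

Lemma adapted_lfil_sum v : v =
  \sum_j (v *m map_mx res U') 0 j *: row j (map_mx res U).
Proof.
by rewrite -mulmx_sum_row -mulmxA -map_mxM UU' map_mx1 mulmx1.
Qed.

Lemma dim_lfil i : \dim (lfil Q i) = #|[pred j | i <= a 0 j]|.
Proof.
pose X := [tuple row j (map_mx res U) | j < n].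
have XE (j : 'I_n) : X`_j = row j (map_mx res U) by rewrite -tnth_nth
  tnth_mktuple.
have freeX : free X.
  apply/freeP => c; under eq_bigr do rewrite XE.
  have -> : \sum_j c j *: row j (map_mx res U) = (\row_j c j) *m map_mx res U.
    by rewrite mulmx_sum_row; apply: eq_bigr => j _; rewrite mxE.
  move=> /(congr1 (mulmxr (map_mx res U'))) /=.
  rewrite -mulmxA -map_mxM UU map_mx1 mulmx1 mul0mx => /rowP c0 j.
  by have := c0 j; rewrite !mxE.
pose Xi := filter (mem (lfil Q i)) X.
have -> : lfil Q i = <<Xi>>%VS.
  apply/eqP; rewrite eqEsubv; apply/andP; split; last first.
    by apply/span_subvP => x; rewrite mem_filter => /andP[].
  apply/subvP => v vi; rewrite [v]adapted_lfil_sum; apply: rpred_sum => j _.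
  have [->|cN] := eqVneq ((v *m map_mx res U') 0 j) 0; first by rewrite scale0r
    rpred0.
  apply/rpredZ/memv_span; rewrite mem_filter inE adapted_row_lfil.
  by rewrite ((adapted_lfil i v).1 vi) //=; apply: map_f; rewrite mem_enum.
have /eqP -> : \dim <<Xi>>%VS == size Xi by exact: filter_free.
rewrite /Xi size_filter count_map -sum1_count -sum1_card big_enum_cond.
by apply: eq_bigl => j; rewrite inE /= adapted_row_lfil.
Qed.

Definition weights (b : 'rV[int]_n) : seq int := [seq b 0 j | j <- enum 'I_n].

Lemma dim_lfil_count i :
  \dim (lfil Q i) = count (fun x => i <= x) (weights a).
Proof.
rewrite dim_lfil count_map -sum1_count -sum1_card big_enum_cond.
by apply: eq_bigl => j; rewrite !inE.
Qed.

Lemma adapted_filtration : is_filtration (lfil Q).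
Proof.
split.
- move=> i j ij; apply/subvP => v /adapted_lfil vj; apply/adapted_lfil => l /vj.
  exact: le_trans.
(* Any index below all the weights works; the default [0] covers the empty case. *)
- move=> v; exists (\big[Order.min/0]_j a 0 j); apply/adapted_lfil => j _.
  exact: bigmin_le_cond.
- move=> v vF; rewrite [v]adapted_lfil_sum big1 // => j _.
  apply/eqP; rewrite scaler_eq0; apply/orP; left.
  apply: contraT => /((adapted_lfil (a 0 j + 1) v).1 (vF _) j).
  by rewrite leNgt ltzD1 lexx.
Qed.

Lemma count_weights i :
  count_mem i (weights a) = (\dim (lfil Q i) - \dim (lfil Q (i + 1)%R))%N.
Proof.
rewrite !dim_lfil -(cardID [pred j | i + 1 <= a 0 j] [pred j | i <= a 0 j]).
rewrite [X in (X + _ - _)%N](_ : _ = #|[pred j | i + 1 <= a 0 j]|); last first.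
  by apply: eq_card => j; rewrite !inE; case: (leP (i + 1)) => //; lia.
rewrite addKn /weights count_map -sum1_count -sum1_card big_enum_cond.
by apply: eq_bigl => j; rewrite !inE /=; lia.
Qed.

(** A sorted sequence is determined by its multiplicities, which [count_weights] identifies with the
    graded dimensions. *)
Lemma fil_type_lfil : fil_type (lfil Q) = sort >=%R (weights a).
Proof.
rewrite /fil_type; set P := [set _ | _].
have P0 : P (sort >=%R (weights a)).
  split; first exact/sort_sorted/ge_total.
  by move=> i; rewrite -count_weights; apply: (seq.permP _); rewrite perm_sort.
case: xgetP => [t -> [st ct]|/(_ _ P0) //].
apply: (sorted_eq ge_trans ge_anti) => //; first exact/sort_sorted/ge_total.
rewrite /perm_eq; apply/allP => x _ /=.
by rewrite ct -P0.2.
Qed.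

End Adapted.

(** * Valuations of determinants and sums of two lattices *)

Lemma dr_isval_neq0 x n : dr_isval (B := B) x n -> x != 0.
Proof.
move=> [b [b' [/(congr1 iL) + ->]]]; rewrite rmorphM rmorph1 => bb.
rewrite mulf_neq0 ?expfz_neq0 ?dr_frac_unif_neq0 //.
by apply/eqP => b0; move/eqP: bb; rewrite b0 mul0r eq_sym oner_eq0.
Qed.

Lemma dr_isvalM x y m n : dr_isval (B := B) x m -> dr_isval (B := B) y n ->
  dr_isval (B := B) (x * y) (m + n).
Proof.
move=> [b [b' [bb ->]]] [c [c' [cc ->]]]; exists (b * c), (b' * c').
rewrite mulrACA bb cc mulr1; split=> //.
by rewrite mulrACA -expfzDr ?dr_frac_unif_neq0 // rmorphM.
Qed.

Lemma dr_isvalV x n : dr_isval (B := B) x n -> dr_isval (B := B) x^-1 (- n).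
Proof.
move=> [b [b' [bb ->]]]; exists b', b; rewrite mulrC bb; split=> //.
rewrite invfM invr_expz; congr (_ * _).
by apply: mulr1_eq; rewrite -rmorphM bb rmorph1.
Qed.

Lemma dr_isval_cancel x y m n : dr_isval (B := B) (x * y) m ->
  dr_isval (B := B) y n -> dr_isval (B := B) x (m - n).
Proof.
move=> xym yn; rewrite -(mulfK (dr_isval_neq0 yn) x).
exact: dr_isvalM xym (dr_isvalV yn).
Qed.

Lemma dr_isval_unit b b' : b * b' = 1 -> dr_isval (B := B) (iL b) 0.
Proof. by move=> bb; exists b, b'; rewrite expr0z mul1r. Qed.

Lemma dr_isval_ge0 b n : dr_isval (B := B) (iL b) n -> 0 <= n.
Proof.
by move=> [c [c' [cc E]]]; apply/(dr_intP unif_neq0 n (dr_unit_res cc)); exists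
  b.
Qed.

Lemma dr_isval0 b : dr_isval (B := B) (iL b) 0 -> exists b', b * b' = 1.
Proof.
by move=> [c [c' [cc]]]; rewrite expr0z mul1r => /dr_to_frac_inj ->; exists c'.
Qed.

Lemma dr_isval_det_inv n (V V' : 'M[B]_n) : V *m V' = 1%:M ->
  dr_isval (B := B) (\det (map_mx iL V)) 0.
Proof.
move=> VV; rewrite det_map_mx; apply: (@dr_isval_unit _ (\det V')).
by rewrite -det_mulmx VV det1.
Qed.

Lemma dr_isval_det_tau n (a : 'rV[int]_n) :
  dr_isval (B := B) (\det (tau_mx a)) (\sum_j a 0 j).
Proof.
exists 1, 1; rewrite rmorph1 !mulr1; split=> //; rewrite /tau_mx det_diag.
apply: (big_rec2 (fun x y => x = tau ^ y)) => [|j x y _ ->].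
  by rewrite expr0z.
by rewrite mxE expfzDr ?dr_frac_unif_neq0.
Qed.

Lemma adapted_det n (Q : 'M[L]_n) a U U' : adapted Q a U U' ->
  dr_isval (B := B) (\det Q) (- \sum_j a 0 j).
Proof.
move=> [UU [V [V' [VV ->]]]]; rewrite !det_mulmx.
have := dr_isvalM (dr_isval_det_inv VV) (dr_isval_det_tau (- a)).
move=> /dr_isvalM -/(_ _ _ (dr_isval_det_inv UU)); rewrite add0r addr0.
by rewrite -sumrN; under eq_bigr do rewrite mxE.
Qed.

(* For [Q] with adapted basis [U], the rows of [thick_mx a U c] are a basis   *)
(* of the lattice L1 + tau^c L2, where L1 is the standard lattice and L2 is   *)
(* spanned by the rows of [Q].                                                *)
Definition thick_wt n (a : 'rV[int]_n) (c : int) : 'rV[int]_n :=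
  \row_j Num.min 0 (c - a 0 j).

Definition thick_mx n (a : 'rV[int]_n) (U : 'M[B]_n) c : 'M[L]_n :=
  tau_mx (thick_wt a c) *m map_mx iL U.

(** Along the [j]-th adapted vector the lattices are generated by [1] and [tau ^ (c - a 0 j)]; their
    sum is generated by the one of smaller exponent. *)
Lemma thick_mxP n (Q : 'M[L]_n) a U U' c y : adapted Q a U U' ->
  (exists b : 'rV[B]_n, y = map_mx iL b *m thick_mx a U c) <->
  exists p w : 'rV[B]_n, y = map_mx iL p + tau ^ c *: (map_mx iL w *m Q).
Proof.
move=> [UU [V [V' [VV QE]]]].
have UU' := mulmx1C UU; have VV' := mulmx1C VV.
have t0 := dr_frac_unif_neq0 unif_neq0.
split=> [[b ->]|[p [w ->]]].
  (* [p] takes the coordinates whose generator comes from the standard lattice, [w] the others. *)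
  pose p := \row_j (if c <= a 0 j then 0 else b 0 j).
  pose w := \row_j (if c <= a 0 j then b 0 j else 0).
  exists (p *m U), (w *m V').
  rewrite !map_mxM QE !mulmxA -(mulmxA (map_mx iL w)) -(map_mxM _ V') VV'
    map_mx1.
  rewrite mulmx1 scalemxAl -mulmxDl; congr (_ *m _).
  apply/rowP => j; rewrite /tau_mx !mul_mx_diag !mxE; case: leP => caj.
    rewrite rmorph0 add0r mulrCA -expfzDr //.
    by rewrite (_ : Num.min _ _ = c - a 0 j) //; lia.
  by rewrite rmorph0 mul0r mulr0 addr0 (_ : Num.min _ _ = 0) ?expr0z ?mulr1 //;
    lia.
pose q := p *m U'; pose z := w *m V.
(* The excesses of the exponents of the two generators over their minimum. *)
pose e j : nat := absz (0 - Num.min 0 (c - a 0 j))%R.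
pose e' j : nat := absz (c - a 0 j - Num.min 0 (c - a 0 j))%R.
exists (\row_j (q 0 j * pi ^+ e j + z 0 j * pi ^+ e' j)).
have -> : map_mx iL p = map_mx iL q *m map_mx iL U.
  by rewrite -map_mxM /q -mulmxA UU' mulmx1.
rewrite QE !mulmxA scalemxAl -mulmxDl -map_mxM -/z; congr (_ *m _).
clearbody q z; apply/rowP => j; rewrite /tau_mx !mul_mx_diag !mxE.
rewrite rmorphD !rmorphM !rmorphXn mulrDl -!mulrA !exprnP -!expfzDr //.
rewrite /e /e' !gez0_abs; try lia.
rewrite !subrK expr0z mulr1 mulrCA -expfzDr //.
Qed.

Lemma det_thick_mx n (a : 'rV[int]_n) (U U' : 'M[B]_n) c : U *m U' = 1%:M ->
  dr_isval (B := B) (\det (thick_mx a U c)) (\sum_j Num.min 0 (c - a 0 j)).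
Proof.
move=> UU; rewrite det_mulmx.
have := dr_isvalM (dr_isval_det_tau (thick_wt a c)) (dr_isval_det_inv UU).
by rewrite addr0; under eq_bigr do rewrite mxE.
Qed.

(** * Exact sequences of lattices and of lattice pairs *)

Section SplitSequence.
Variables (n1 n2 n3 : nat) (f : 'M[B]_(n1, n2)) (g : 'M[B]_(n2, n3)).
Variables (r : 'M[B]_(n2, n1)) (s : 'M[B]_(n3, n2)).
Hypotheses (n123 : (n1 + n3)%N = n2) (fr : f *m r = 1%:M) (sg : s *m g = 1%:M).
Hypotheses (fg : f *m g = 0) (sr : s *m r = 0).
Variables (G1 : 'M[L]_n1) (G2 : 'M[L]_n2) (G3 : 'M[L]_n3) (d1 d2 d3 : int).
Hypotheses (G1d : dr_isval (B := B) (\det G1) d1).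
Hypotheses (G2d : dr_isval (B := B) (\det G2) d2).
Hypotheses (G3d : dr_isval (B := B) (\det G3) d3).
Variables (X : 'M[B]_(n1, n2)) (Z : 'M[B]_(n3, n2)).
Hypothesis G1X : G1 *m map_mx iL f = map_mx iL X *m G2.
Hypothesis G3Z : map_mx iL Z *m G2 *m map_mx iL g = G3.

(* The matrix [col_mx X Z] expresses a basis of the sublattice generated by   *)
(* the image of the first lattice and a lift of the third one in terms of the *)
(* basis [G2]; its determinant has valuation [d1 + d3 - d2].                  *)
Lemma split_sequence_det :
  exists2 D : B, dr_isval (B := B) (iL D) (d1 + d3 - d2) &
    (exists D', D * D' = 1) <->
    exists N : 'M[B]_(n2, n1 + n3), N *m col_mx X Z = 1%:M.
Proof.
(* The data are generalized so that [n2] can be replaced by [n1 + n3], which makes [col_mx X Z] a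
   square matrix. *)
move: (fr) (sg) (fg) (sr) (G2d) (G1X) (G3Z).
move: (f) (g) (r) (s) (G2) (X) (Z); case: _ / n123.
move=> f' g' r' s' G2' X' Z' fr' sg' fg' sr' G2d' G1X' G3Z'.
exists (\det (col_mx X' Z')); last first.
  split=> [[D' DD]|[N NXZ]].
    exists (D' *: \adj (col_mx X' Z')).
    by rewrite -scalemxAl mul_adj_mx scale_scalar_mx mulrC DD.
  by exists (\det N); rewrite -det_mulmx (mulmx1C NXZ) det1.
have inv : col_mx f' s' *m row_mx r' g' = 1%:M.
  by rewrite mul_col_row fr' sg' fg' sr' scalar_mx_block.
have := dr_isvalM G1d G3d; rewrite -(det_lblock _ (map_mx iL Z' *m G2' *m
  map_mx iL r')).
(* In the bases given by the splitting, the matrix is block triangular with diagonal blocks [G1] and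
   [G3]; the change of basis is invertible over [B]. *)
have <- : map_mx iL (col_mx X' Z') *m G2' *m map_mx iL (row_mx r' g') =
    block_mx G1 0 (map_mx iL Z' *m G2' *m map_mx iL r') G3.
  rewrite map_col_mx map_row_mx mul_col_mx mul_col_row -G1X' -!mulmxA -!map_mxM.
  by rewrite fr' fg' map_mx1 map_mx0 mulmx1 mulmx0 !mulmxA G3Z'.
rewrite !det_mulmx det_map_mx => E.
have := dr_isval_cancel E (dr_isval_det_inv (mulmx1C inv)).
by rewrite subr0 => /dr_isval_cancel; apply.
Qed.

Lemma split_sequence_det_le : d2 <= d1 + d3.
Proof.
by have [D /dr_isval_ge0 + _] := split_sequence_det; rewrite subr_ge0.
Qed.

Lemma split_sequence_det_eq :
  d2 = d1 + d3 <-> exists N : 'M[B]_(n2, n1 + n3), N *m col_mx X Z = 1%:M.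
Proof.
have [D Dv D1] := split_sequence_det; apply: iff_trans D1; split.
  by move=> d123; move: Dv; rewrite d123 subrr => /dr_isval0.
move=> [D' DD]; have := dr_isval_cancel (m := 0) (y := iL D) (x := iL D') _ Dv.
rewrite -rmorphM mulrC DD => /(_ (dr_isval_unit (mulr1 1))) /dr_isval_ge0.
by have := dr_isval_ge0 Dv; lia.
Qed.

(** When the valuations add up, [col_mx X Z] is invertible, so [b] is a combination of the rows of
    [X] and [Z]. The part along [Z] maps to zero in the third lattice, hence vanishes since [G3] is
    invertible. *)
Lemma split_sequence_sub x (b : 'rV[B]_n2) : d2 = d1 + d3 ->
  x *m map_mx iL f = map_mx iL b *m G2 -> exists b1, x = map_mx iL b1 *m G1.
Proof.
move=> /split_sequence_det_eq [N NXZ] xb.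
pose b1 := lsubmx (b *m N); pose b3 := rsubmx (b *m N).
have bE : b = b1 *m X + b3 *m Z.
  by rewrite -mul_row_col hsubmxK -mulmxA NXZ mulmx1.
have b30 : map_mx iL b3 *m G3 = 0.
  have := congr1 (mulmxr (map_mx iL g)) xb; rewrite /= -mulmxA -map_mxM fg.
  rewrite map_mx0 mulmx0 bE map_mxD !map_mxM mulmxDl -(mulmxA _ _ G2) -G1X.
  rewrite mulmxDl -!mulmxA -map_mxM fg map_mx0 !mulmx0 add0r.
  by rewrite (mulmxA (map_mx iL Z)) G3Z.
have G3u : G3 \in unitmx by rewrite unitmxE unitfE (dr_isval_neq0 G3d).
have b3E : map_mx iL b3 = 0 by rewrite -(mulmxK G3u (map_mx iL b3)) b30 mul0mx.
exists b1; rewrite -[x]mulmx1 -[map_mx iL b1 *m G1]mulmx1 -(map_mx1 iL) -fr.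
rewrite map_mxM !mulmxA xb bE map_mxD !map_mxM b3E mul0mx addr0.
by rewrite -(mulmxA _ _ G2) -G1X !mulmxA.
Qed.

End SplitSequence.
Lemma row_lattice m n (Y : 'M[L]_(m, n)) (G : 'M[L]_n) :
  (forall i, exists b : 'rV[B]_n, row i Y = map_mx iL b *m G) ->
  exists X : 'M[B]_(m, n), Y = map_mx iL X *m G.
Proof.
move=> /boolp.choice [b bE]; exists (\matrix_i b i).
by apply/row_matrixP => i; rewrite bE row_mul -map_row rowK.
Qed.

Lemma res_mx_eq0 m n (x : 'M[B]_(m, n)) : map_mx res x = 0 ->
  exists y, x = pi *: y.
Proof.
move=> /matrixP x0.
have /boolp.choice [y yE] : forall p : 'I_m * 'I_n, exists c, x p.1 p.2 = pi *
  c.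
  by move=> p; apply/(dr_resP B).2; have := x0 p.1 p.2; rewrite !mxE.
by exists (\matrix_(i, j) y (i, j)); apply/matrixP => i j; rewrite !mxE -yE.
Qed.

Section ExactSequence.
Variables (n1 n2 n3 : nat) (n123 : (n1 + n3)%N = n2).
Variables (f0 f1 : 'M[B]_(n1, n2)) (g0 g1 : 'M[B]_(n2, n3)).
Variables (r0 r1 : 'M[B]_(n2, n1)) (s0 s1 : 'M[B]_(n3, n2)).
Hypotheses (fr0 : f0 *m r0 = 1%:M) (sg0 : s0 *m g0 = 1%:M) (fg0 : f0 *m g0 = 0).
Hypotheses (sr0 : s0 *m r0 = 0) (rf0 : r0 *m f0 + g0 *m s0 = 1%:M).
Hypotheses (sg1 : s1 *m g1 = 1%:M) (rf1 : r1 *m f1 + g1 *m s1 = 1%:M).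
Variables (Q1 : 'M[L]_n1) (Q2 : 'M[L]_n2) (Q3 : 'M[L]_n3).
Hypothesis Q12 : Q1 *m map_mx iL f0 = map_mx iL f1 *m Q2.
Hypothesis Q23 : Q2 *m map_mx iL g0 = map_mx iL g1 *m Q3.
Variables (a1 : 'rV[int]_n1) (U1 U1' : 'M[B]_n1) (aQ1 : adapted Q1 a1 U1 U1').
Variables (a2 : 'rV[int]_n2) (U2 U2' : 'M[B]_n2) (aQ2 : adapted Q2 a2 U2 U2').
Variables (a3 : 'rV[int]_n3) (U3 U3' : 'M[B]_n3) (aQ3 : adapted Q3 a3 U3 U3').

Lemma thick_sub c : exists X : 'M[B]_(n1, n2),
  thick_mx a1 U1 c *m map_mx iL f0 = map_mx iL X *m thick_mx a2 U2 c.
Proof.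
apply: row_lattice => i; apply/(thick_mxP c _ aQ2).
have [|p [w E]] := (thick_mxP c (row i (thick_mx a1 U1 c)) aQ1).1.
  by exists (delta_mx 0 i); rewrite map_delta_mx -rowE.
exists (p *m f0), (w *m f1); rewrite row_mul E mulmxDl -scalemxAl !map_mxM.
by rewrite -!mulmxA Q12.
Qed.

(** The summand in the standard lattice is lifted by [s0], the one in the second lattice by [s1]. *)
Lemma thick_quot c : exists Z : 'M[B]_(n3, n2),
  map_mx iL Z *m thick_mx a2 U2 c *m map_mx iL g0 = thick_mx a3 U3 c.
Proof.
have Q3E : Q3 = map_mx iL s1 *m Q2 *m map_mx iL g0.
  by rewrite -mulmxA Q23 mulmxA -map_mxM sg1 map_mx1 mul1mx.
have /boolp.choice [z zE] : forall i, exists z : 'rV[B]_n2,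
    map_mx iL z *m thick_mx a2 U2 c *m map_mx iL g0 = row i (thick_mx a3 U3 c).
  move=> i; have [|p [w ->]] := (thick_mxP c (row i (thick_mx a3 U3 c)) aQ3).1.
    by exists (delta_mx 0 i); rewrite map_delta_mx -rowE.
  have [|z zE] := (thick_mxP c (map_mx iL (p *m s0) +
    tau ^ c *: (map_mx iL (w *m s1) *m Q2)) aQ2).2; first by exists (p *m s0),
      (w *m s1).
  exists z; rewrite -zE mulmxDl -scalemxAl !map_mxM -!mulmxA -map_mxM sg0
    map_mx1 mulmx1.
  by rewrite Q3E !mulmxA.
exists (\matrix_i z i); apply/row_matrixP => i.
by rewrite -zE !row_mul -map_row rowK.
Qed.

Lemma thick_le c : \sum_j Num.min 0 (c - a2 0 j) <=
  \sum_j Num.min 0 (c - a1 0 j) + \sum_j Num.min 0 (c - a3 0 j).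
Proof.
have [X XE] := thick_sub c; have [Z ZE] := thick_quot c.
have [[UU1 _] [UU2 _] [UU3 _]] := And3 aQ1 aQ2 aQ3.
exact: (split_sequence_det_le n123 fr0 sg0 fg0 sr0
  (det_thick_mx a1 c UU1) (det_thick_mx a2 c UU2) (det_thick_mx a3 c UU3) XE
    ZE).
Qed.

(** The second lattices form a split exact sequence on their own, so the valuations of the
    determinants of [Q1], [Q2], [Q3] add up exactly. *)
Lemma sum_weights : \sum_j a2 0 j = \sum_j a1 0 j + \sum_j a3 0 j.
Proof.
have ZE : map_mx iL s1 *m Q2 *m map_mx iL g0 = Q3.
  by rewrite -mulmxA Q23 mulmxA -map_mxM sg1 map_mx1 mul1mx.
suff /(split_sequence_det_eq n123 fr0 sg0 fg0 sr0 (adapted_det aQ1)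
  (adapted_det aQ2) (adapted_det aQ3) Q12 ZE).2 :
    exists N, N *m col_mx f1 s1 = 1%:M by lia.
by exists (row_mx r1 g1); rewrite mul_row_col.
Qed.

(** Let [x] lift [v]. Then [x *m f0] is, modulo [pi], in [tau ^ (c + 1)] times the second lattice;
    dividing by [tau] puts it in the sum lattice of index [c], whence the shift by one. By
    [split_sequence_sub] the same holds for [x] divided by [tau], and multiplying back corrects [x]
    by a multiple of [pi]. *)
Lemma thick_eq_lfil c v : \sum_j Num.min 0 (c - a2 0 j) =
    \sum_j Num.min 0 (c - a1 0 j) + \sum_j Num.min 0 (c - a3 0 j) ->
  v *m map_mx res f0 \in lfil Q2 (c + 1) -> v \in lfil Q1 (c + 1).
Proof.
move=> eqc /lfilP [y [w [yE wE]]].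
have [X XE] := thick_sub c; have [Z ZE] := thick_quot c.
have [[UU1 _] [UU2 _] [UU3 _]] := And3 aQ1 aQ2 aQ3.
have t0 : tau != 0 by exact: dr_frac_unif_neq0.
have [x xv] : exists x : 'rV[B]_n1, map_mx res x = v.
  have /boolp.choice [x xE] : forall j, exists b, res b = v 0 j.
    by move=> j; apply: (dr_resP B).1.
  by exists (\row_j x j); apply/rowP => j; rewrite !mxE.
have [z zE] : exists z, x *m f0 - y = pi *: z.
  by apply: res_mx_eq0; rewrite map_mxB map_mxM xv yE subrr.
have [b bE] : exists b : 'rV[B]_n2,
    (tau^-1 *: map_mx iL x) *m map_mx iL f0 = map_mx iL b *m thick_mx a2 U2 c.
  apply/(thick_mxP c _ aQ2); exists z, w.
  rewrite -scalemxAl -map_mxM -[x *m f0](subrK y) zE map_mxD map_mxZ wE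
    scalerDr.
  by rewrite !scalerA mulVf // scale1r expfzDr // expr1z mulrCA mulVf // mulr1.
have [b1 b1E] := split_sequence_sub n123 fr0 sg0 fg0 sr0
  (det_thick_mx a1 c UU1) (det_thick_mx a2 c UU2) (det_thick_mx a3 c UU3)
  XE ZE eqc bE.
have [|p [w1 pE]] := (thick_mxP c (tau^-1 *: map_mx iL x) aQ1).1; first by
  exists b1.
apply/lfilP; exists (x - pi *: p), w1; split.
  by rewrite map_mxB map_mxZ dr_res_unif scale0r subr0.
rewrite map_mxB map_mxZ -[map_mx iL x](scalerKV t0) pE scalerDr addrC addrA
  addNr add0r.
by rewrite scalerA expfzDr // expr1z mulrC.
Qed.

Lemma sum_weightsE n (a : 'rV[int]_n) (h : int -> int) :
  \sum_(x <- weights a) h x = \sum_j h (a 0 j).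
Proof. by rewrite big_map big_enum. Qed.

Lemma size_weights n (a : 'rV[int]_n) : size (weights a) = n.
Proof. by rewrite size_map size_enum_ord. Qed.

Lemma lfil_exact_type_le : type_le n2
  (type_cat (fil_type (lfil Q1)) (fil_type (lfil Q3))) (fil_type (lfil Q2)).
Proof.
rewrite (fil_type_lfil aQ1) (fil_type_lfil aQ2) (fil_type_lfil aQ3).
apply: type_le_sort.
- by rewrite size_cat !size_sort !size_weights.
- exact: size_weights.
- rewrite big_cat !(perm_big _ (permEl (perm_sort _ _))) /=.
  by rewrite !(sum_weightsE _ id) sum_weights.
- move=> c; rewrite big_cat !(perm_big _ (permEl (perm_sort _ _))) /=.
  by rewrite !sum_weightsE thick_le.
Qed.

Lemma lfil_type_catE :
  type_cat (fil_type (lfil Q1)) (fil_type (lfil Q3)) = fil_type (lfil Q2) <->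
  perm_eq (weights a1 ++ weights a3) (weights a2).
Proof.
rewrite (fil_type_lfil aQ1) (fil_type_lfil aQ2) (fil_type_lfil aQ3) /type_cat.
have -> : sort >=%R (sort >=%R (weights a1) ++ sort >=%R (weights a3)) =
    sort >=%R (weights a1 ++ weights a3).
  by apply/(perm_sortP ge_total ge_trans ge_anti)/perm_cat; rewrite perm_sort.
exact: (rwP (perm_sortP ge_total ge_trans ge_anti _ _)).
Qed.

Local Notation F0 := (map_mx res f0).
Local Notation G0 := (map_mx res g0).

Let F0K (x : 'rV[k]_n1) : x *m F0 *m map_mx res r0 = x.
Proof. by rewrite -mulmxA -map_mxM fr0 map_mx1 mulmx1. Qed.

Let ker_G0 (y : 'rV[k]_n2) : y *m G0 = 0 -> y = y *m map_mx res r0 *m F0.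
Proof.
move=> yG; rewrite -[LHS]mulmx1 -(map_mx1 res) -rf0 map_mxD !map_mxM mulmxDr.
by rewrite !mulmxA yG mul0mx addr0.
Qed.

(** The sequence of residue spaces is split exact. The first condition identifies the image of
    [lfil Q1 i] with the kernel on [lfil Q2 i], and surjectivity is then a matter of dimensions. *)
Lemma lfil_short_exact_dim i :
  short_exact [set` lfil Q1 i] [set` lfil Q2 i] [set` lfil Q3 i]
    (mulmxr F0) (mulmxr G0) <->
  (forall v, v *m F0 \in lfil Q2 i -> v \in lfil Q1 i) /\
  (\dim (lfil Q2 i) = \dim (lfil Q1 i) + \dim (lfil Q3 i))%N.
Proof.
pose Fl := linfun (mulmxr F0 : 'rV_n1 -> 'rV_n2).
pose Gl := linfun (mulmxr G0 : 'rV_n2 -> 'rV_n3).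
have dF : \dim (Fl @: lfil Q1 i) = \dim (lfil Q1 i).
  apply/limg_dim_eq/eqP; rewrite -subv0; apply/subvP => x /memv_capP [_].
  by rewrite memv_ker lfunE /= memv0 => /eqP x0; rewrite -(F0K x) x0 mul0mx.
have dG : (\dim (lfil Q2 i :&: lker Gl) + \dim (Gl @: lfil Q2 i) = \dim (lfil
  Q2 i))%N.
  exact: limg_ker_dim.
have FK : (Fl @: lfil Q1 i <= lfil Q2 i :&: lker Gl)%VS.
  apply/subvP => _ /memv_imgP [x xi ->]; rewrite memv_cap memv_ker !lfunE /=.
  rewrite (lfil_mor Q12 xi) /= -mulmxA -map_mxM fg0.
  by rewrite map_mx0 mulmx0.
have GI : (Gl @: lfil Q2 i <= lfil Q3 i)%VS.
  by apply/subvP => _ /memv_imgP [y yi ->]; rewrite lfunE /= (lfil_mor Q23 yi).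
split=> [[F12 G23 _ kerE surj]|[inF dimE]].
  have FKE : (Fl @: lfil Q1 i)%VS = (lfil Q2 i :&: lker Gl)%VS.
    apply/eqP; rewrite eqEsubv FK; apply/subvP => y /memv_capP [yi].
    rewrite memv_ker lfunE /= => /eqP /((kerE y yi).1) [x [xi <-]].
    by apply/memv_imgP; exists x; rewrite ?lfunE.
  have GIE : (Gl @: lfil Q2 i)%VS = lfil Q3 i.
    apply/eqP; rewrite eqEsubv GI; apply/subvP => z /surj [y [yi <-]].
    by apply/memv_imgP; exists y; rewrite ?lfunE.
  split; last by rewrite -dG -FKE dF GIE.
  move=> v vi; have [|x [xi]] := (kerE _ vi).1.
    by rewrite /= -mulmxA -map_mxM fg0 map_mx0 mulmx0.
  by move=> /(congr1 (mulmxr (map_mx res r0))); rewrite /= !F0K => <-.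
have FKE : (Fl @: lfil Q1 i)%VS = (lfil Q2 i :&: lker Gl)%VS.
  apply/eqP; rewrite eqEsubv FK; apply/subvP => y /memv_capP [yi].
  rewrite memv_ker lfunE /= => /eqP /ker_G0 yE; apply/memv_imgP.
  exists (y *m map_mx res r0); last by rewrite lfunE.
  apply: inF; rewrite -yE; exact: yi.
have GIE : (Gl @: lfil Q2 i)%VS = lfil Q3 i.
  apply/eqP; rewrite eqEdim GI -(leq_add2l (\dim (lfil Q1 i))) -dimE -dG.
  by rewrite -FKE dF leqnn.
split.
- by move=> x xi; apply: (lfil_mor Q12).
- by move=> x xi; apply: (lfil_mor Q23).
- by move=> x _ /= x0; rewrite -(F0K x) x0 mul0mx.
- move=> y yi; split=> [|[x [_ <-]]]; last first.
    by rewrite /= -mulmxA -map_mxM fg0 map_mx0 mulmx0.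
  move=> yG; have : y \in (Fl @: lfil Q1 i)%VS.
    by rewrite FKE memv_cap yi memv_ker lfunE; apply/eqP.
  by move=> /memv_imgP [x xi ->]; exists x; rewrite lfunE.
- move=> z; rewrite /= -GIE => /memv_imgP [y yi ->].
  by exists y; rewrite lfunE.
Qed.

(** Equal types give equal truncated sums for every [c], hence strictness, and additive dimensions.
    Conversely, additive dimensions give additive graded dimensions, that is, equal multiplicities
    of weights. *)
Lemma lfil_exactP :
  type_cat (fil_type (lfil Q1)) (fil_type (lfil Q3)) = fil_type (lfil Q2) <->
  forall i, short_exact [set` lfil Q1 i] [set` lfil Q2 i] [set` lfil Q3 i]
    (mulmxr F0) (mulmxr G0).
Proof.
apply: iff_trans lfil_type_catE _; split=> [pw i|ex].
  apply/lfil_short_exact_dim; split.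
    move=> v; have := @thick_eq_lfil (i - 1) v; rewrite subrK; apply.
    rewrite -!(sum_weightsE _ (fun z => Num.min 0 (i - 1 - z))) -big_cat.
    by rewrite (perm_big _ pw).
  rewrite (dim_lfil_count aQ1) (dim_lfil_count aQ2) (dim_lfil_count aQ3).
  by rewrite -(seq.permP pw) count_cat.
apply/allP => x _ /=; rewrite count_cat.
rewrite (count_weights aQ1) (count_weights aQ2) (count_weights aQ3).
have dimE i := ((lfil_short_exact_dim i).1 (ex i)).2; rewrite !dimE.
(* Monotonicity makes the truncated subtractions of dimensions exact. *)
have le_dim n (Q : 'M[L]_n) a U U' (aQ : adapted Q a U U') :
    (\dim (lfil Q (x + 1)%R) <= \dim (lfil Q x))%N.
  by have [dec _ _] := adapted_filtration aQ; apply/dimvS/dec; lia.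
have := le_dim _ _ _ _ _ aQ1; have := le_dim _ _ _ _ _ aQ3; lia.
Qed.

End ExactSequence.

(** * Tensor products, tensor powers, retracts and duals of lattice pairs *)

Lemma tau_mxE n (a : 'rV[int]_n) x y : tau_mx a x y = tau ^ a 0 x *+ (x == y).
Proof. by rewrite /tau_mx !mxE. Qed.

Section TensorLattices.
Variables (m n : nat) (P : 'M[L]_m) (Q : 'M[L]_n).
Variables (a : 'rV[int]_m) (U U' : 'M[B]_m) (aP : adapted P a U U').
Variables (b : 'rV[int]_n) (W W' : 'M[B]_n) (bQ : adapted Q b W W').

Definition kron_wt : 'rV[int]_#|{: 'I_m * 'I_n}| :=
  frow (fun h : 'I_m * 'I_n => a 0 h.1 + b 0 h.2).

Lemma adapted_kron : adapted (kron P Q) kron_wt (kron U W) (kron U' W').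
Proof.
have [UU [V [V' [VV ->]]]] := aP; have [WW [T [T' [TT ->]]]] := bQ.
split; first by rewrite kronM UU WW kron1.
exists (kron V T), (kron V' T'); split; first by rewrite kronM VV TT kron1.
rewrite !map_kron -!kronM; congr (_ *m _ *m _).
apply/matrixP => x y; rewrite tau_mxE !mxE.
rewrite -[x == y](inj_eq enum_val_inj); case: (enum_val x) (enum_val y) => x1
  x2 [y1 y2] /=.
rewrite xpair_eqE opprD expfzDr ?dr_frac_unif_neq0 // -mulnb.
by rewrite mulrnAr mulrnAl -mulrnA.
Qed.

Lemma lfil_kron_span i : is_span (lfil (kron P Q) i)
  [set z | exists i1 i2 x y, [/\ i1 + i2 = i, x \in lfil P i1, y \in lfil Q i2
                               & z = krow x y]].
Proof.
split=> [_ [i1 [i2 [x [y [<- xi yi ->]]]]]|V XV].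
  apply/(adapted_lfil adapted_kron) => h.
  rewrite map_kron krow_kron [_ 0 h]mxE mulf_eq0 negb_or => /andP[xh yh].
  rewrite [kron_wt 0 h]mxE; apply: lerD.
    exact: (adapted_lfil aP _ _).1 xi _ xh.
  exact: (adapted_lfil bQ _ _).1 yi _ yh.
apply/subvP => z zi; rewrite [z](adapted_lfil_sum adapted_kron).
apply: rpred_sum => h _; set c := (_ 0 h).
have [->|cN] := eqVneq c 0; first by rewrite scale0r rpred0.
have := (adapted_lfil adapted_kron _ _).1 zi h cN; rewrite mxE => ih.
(* The two indices must sum to exactly [i], so the second is lowered from the weight of its vector
   to [i] minus the first. *)
apply/rpredZ/XV; exists (a 0 (enum_val h).1), (i - a 0 (enum_val h).1).
exists (row (enum_val h).1 (map_mx res U)), (row (enum_val h).2 (map_mx res W)).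
rewrite (adapted_row_lfil aP) (adapted_row_lfil bQ) lexx lerBlDl ih addrC subrK.
split=> //; rewrite map_kron row_fmx; apply: eq_frow => x.
by rewrite [row _ _ _ _]mxE [row _ (map_mx res W) _ _]mxE.
Qed.

End TensorLattices.

Section TensorPowerLattices.
Variables (r m : nat) (P : 'M[L]_m).
Variables (a : 'rV[int]_m) (U U' : 'M[B]_m) (aP : adapted P a U U').

Definition tpow_wt : 'rV[int]_#|{: {ffun 'I_r -> 'I_m}}| :=
  frow (fun h : {ffun 'I_r -> 'I_m} => \sum_j a 0 (h j)).

Lemma adapted_tpow : adapted (tpow r P) tpow_wt (tpow r U) (tpow r U').
Proof.
have [UU [V [V' [VV ->]]]] := aP; split; first by rewrite tpowM UU tpow1.
exists (tpow r V), (tpow r V'); split; first by rewrite tpowM VV tpow1.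
rewrite !map_tpow -!tpowM; congr (_ *m _ *m _).
apply/matrixP => x y; rewrite tau_mxE !mxE -[x == y](inj_eq enum_val_inj).
move: (enum_val x) (enum_val y) => {}x {}y.
rewrite -mulr_natr -prod_nat_eq -sumrN.
have -> : tau ^ (\sum_j - a 0 (x j)) = \prod_j tau ^ (- a 0 (x j)).
  apply/esym/(big_rec2 (fun u v => u = tau ^ v)) => [|j u' v _ ->].
    by rewrite expr0z.
  by rewrite expfzDr ?dr_frac_unif_neq0.
by rewrite -big_split; apply: eq_bigr => j _; rewrite !mxE /= mulr_natr.
Qed.

Lemma lfil_tpow_span i : is_span (lfil (tpow r P) i)
  [set z | exists (j : {ffun 'I_r -> int}) (x : {ffun 'I_r -> 'rV[k]_m}),
     [/\ i <= \sum_l j l, forall l, x l \in lfil P (j l) & z = trow x]].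
Proof.
split=> [_ [j [x [ij xj ->]]]|V XV].
  apply/(adapted_lfil adapted_tpow) => h.
  rewrite map_tpow trow_tpow [_ 0 h]mxE [tpow_wt 0 h]mxE => /prodf_neq0 xh.
  apply: le_trans ij _.
  by apply: ler_sum => l _; apply: (adapted_lfil aP _ _).1 (xj l) _ (xh l isT).
apply/subvP => z zi; rewrite [z](adapted_lfil_sum adapted_tpow).
apply: rpred_sum => h _; set c := (_ 0 h).
have [->|cN] := eqVneq c 0; first by rewrite scale0r rpred0.
have := (adapted_lfil adapted_tpow _ _).1 zi h cN; rewrite mxE => ih.
apply/rpredZ/XV; exists [ffun l => a 0 (enum_val h l)].
exists [ffun l => row (enum_val h l) (map_mx res U)]; split.
- by under eq_bigr do rewrite ffunE.
- by move=> l; rewrite !ffunE (adapted_row_lfil aP) lexx.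
- rewrite map_tpow row_fmx; apply: eq_frow => x.
  by apply: eq_bigr => l _; rewrite ffunE [row _ _ _ _]mxE.
Qed.

End TensorPowerLattices.

Section Retract.
Variables (m n : nat) (P : 'M[L]_m) (Q : 'M[L]_n).
Variables (b0 b1 : 'M[B]_(m, n)) (g0 g1 : 'M[B]_(n, m)) (e0 e1 : 'M[B]_m) (c :
  B).
Hypothesis Pb : P *m map_mx iL b0 = map_mx iL b1 *m Q.
Hypotheses (gb0 : g0 *m b0 = c%:M) (gb1 : g1 *m b1 = c%:M) (c0 : res c != 0).
Hypotheses (bg0 : b0 *m g0 = e0) (bg1 : b1 *m g1 = e1).
Hypothesis Pe : P *m map_mx iL e0 = map_mx iL e1 *m P.

(** Only [b0], [b1] and the composites [e0], [e1] are known to be morphisms. Multiplied by [c], that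
    is by [g1 *m b1], the relation for [g0], [g1] follows from theirs, and [c] cancels. *)
Lemma retract_mor : Q *m map_mx iL g0 = map_mx iL g1 *m P.
Proof.
have cN : iL c != 0.
  by apply/eqP => /dr_to_frac_eq0 cE; move: c0; rewrite cE rmorph0 eqxx.
apply: (scalerI cN); rewrite -!mul_scalar_mx -!map_scalar_mx -gb1 !map_mxM.
rewrite -!mulmxA (mulmxA _ Q) -Pb (mulmxA (map_mx iL b1)) -map_mxM bg1 -Pe -bg0.
by rewrite map_mxM !mulmxA.
Qed.

(** Going to [P] by [g0] and back by [b0] multiplies by the residue of [c], a nonzero scalar. *)
Lemma lfil_retract_span i X : is_span (lfil P i) X ->
  is_span (lfil Q i) [set y | exists2 x, X x & y = x *m map_mx res b0].
Proof.
move=> [XP minP]; split=> [_ [x /XP xi ->]|V XV]; first exact: (lfil_mor Pb).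
apply/subvP => y yi; pose bl := linfun (mulmxr (map_mx res b0) : 'rV[k]_m ->
  'rV[k]_n).
have /subvP/(_ _ (lfil_mor retract_mor yi)) : (lfil P i <= bl @^-1: V)%VS.
  apply: minP => x Xx; rewrite -memv_preim lfunE /=; apply: XV; by exists x.
rewrite -memv_preim lfunE /= -mulmxA -map_mxM gb0 map_scalar_mx mul_mx_scalar.
by rewrite rpredZeq (negPf c0).
Qed.

End Retract.

Section Dual.
Variables (n : nat) (Q : 'M[L]_n) (a : 'rV[int]_n) (U U' : 'M[B]_n).
Hypothesis aQ : adapted Q a U U'.

Lemma adapted_dual : adapted (invmx Q)^T (- a) U'^T U^T.
Proof.
have [UU [V [V' [VV QE]]]] := aQ.
have Dinv : tau_mx (- a) *m tau_mx a = 1%:M.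
  apply/matrixP => x y; rewrite /tau_mx mul_diag_mx !mxE mulrnAr.
  by rewrite -expfzDr ?dr_frac_unif_neq0 // addNr expr0z.
split; first by rewrite -trmx_mul UU trmx1.
exists V'^T, V^T; split; first by rewrite -trmx_mul VV trmx1.
have -> : invmx Q = map_mx iL U' *m tau_mx a *m map_mx iL V'.
  set T := (X in _ = X).
  have QT : Q *m T = 1%:M.
    rewrite QE /T !mulmxA -(mulmxA _ (map_mx iL U)) -map_mxM UU map_mx1 mulmx1.
    by rewrite -(mulmxA (map_mx iL V)) Dinv mulmx1 -map_mxM VV map_mx1.
  by rewrite -[invmx Q]mulmx1 -QT mulKmx //; case: (mulmx1_unit QT).
rewrite opprK !trmx_mul !map_trmx mulmxA; congr (_ *m _ *m _).
by rewrite /tau_mx tr_diag_mx.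
Qed.

(** In dual adapted bases the pairing is a sum of products of coordinates, and for [- i < j] no
    index has both factors nonzero. Conversely, pairing with the [l]-th adapted vector, which lies
    in step [a 0 l], isolates coordinate [l]. *)
Lemma lfil_dualP i x : x \in lfil (invmx Q)^T i <->
  forall j y, - i < j -> y \in lfil Q j -> x *m y^T = 0.
Proof.
have UU' : U' *m U = 1%:M by apply: mulmx1C; case: aQ.
split=> [/(adapted_lfil adapted_dual) xi j y ij /(adapted_lfil aQ) yj|xy].
  have -> : x *m y^T = x *m map_mx res U^T *m (y *m map_mx res U')^T.
    rewrite trmx_mul mulmxA map_trmx -(mulmxA x) -map_mxM -trmx_mul.
    by rewrite UU' trmx1 map_mx1 mulmx1.
  apply/matrixP => o o'; rewrite !ord1 !mxE big1 // => l _; rewrite [_^T _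
    _]mxE.
  apply/eqP; rewrite mulf_eq0; apply: contraT; rewrite negb_or => /andP[/xi +
    /yj].
  rewrite mxE lerNr => ail /le_trans /(_ ail) /(lt_le_trans ij).
  by rewrite ltxx.
apply/(adapted_lfil adapted_dual) => l; rewrite [(- a) 0 l]mxE; apply:
  contra_neqT.
rewrite -ltNge => lai; have := xy (a 0 l) (row l (map_mx res U)).
rewrite (adapted_row_lfil aQ) lexx => /(_ _ isT) xl.
have /matrixP/(_ 0 0) : x *m (row l (map_mx res U))^T = 0 by apply: xl; rewrite
  ltrNl.
by rewrite !mxE => xl0; rewrite -[RHS]xl0; apply: eq_bigr => z _; rewrite !mxE.
Qed.

End Dual.

End Lattices.
(** * Multilinear maps in coordinates *)

Section VectTypeMatrices.
Variable R : comNzRingType.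
Implicit Types M N T D : vectType R.
Import VectorInternalTheory.

Definition hom_mx M N (f : M -> N) : 'M[R]_(dim M, dim N) :=
  \matrix_i v2r (f (base_vec i)).

Definition bil_mx M N T (b : M -> N -> T) :=
  fstack (fun h : 'I_(dim M) * 'I_(dim N) => v2r (b (base_vec h.1) (base_vec
    h.2))).

Definition form_mx M N (e : M -> N -> R) : 'M[R]_(dim M, dim N) :=
  \matrix_(i, j) e (base_vec i) (base_vec j).

Definition multi_mx M T n (s : {ffun 'I_n -> M} -> T) :=
  fstack (fun h : {ffun 'I_n -> 'I_(dim M)} => v2r (s [ffun j => base_vec (h
    j)])).

Lemma base_vec_sum M (x : M) : x = \sum_i v2r x 0 i *: base_vec i.
Proof.
apply: v2r_inj; rewrite linear_sum [LHS]row_sum_delta; apply: eq_bigr => i _.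
by rewrite linearZ /base_vec /= r2vK.
Qed.

Lemma v2r_base M (i : 'I_(dim M)) : v2r (base_vec i) = delta_mx 0 i.
Proof. exact: r2vK. Qed.

Lemma hom_mxE M N (f : {linear M -> N}) x : v2r (f x) = v2r x *m hom_mx f.
Proof.
rewrite {1}[x]base_vec_sum !linear_sum mulmx_sum_row; apply: eq_bigr => i _.
by rewrite !linearZ rowK.
Qed.

Lemma bilinear_sum M N (P : lmodType R) (b : M -> N -> P) x y : is_bilinear b ->
  b x y = \sum_i \sum_j (v2r x 0 i * v2r y 0 j) *: b (base_vec i) (base_vec j).
Proof.
move=> [bl br]; have bl0 z : b 0 z = 0.
  by have /esym/eqP := bl 1 0 0 z; rewrite !scale1r addr0 -subr_eq0 addrK =>
    /eqP.
have br0 z : b z 0 = 0.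
  by have /esym/eqP := br 1 z 0 0; rewrite !scale1r addr0 -subr_eq0 addrK =>
    /eqP.
transitivity (\sum_i v2r x 0 i *: b (base_vec i) y).
  rewrite {1}[x]base_vec_sum.
  apply: (big_rec2 (fun u v => b u y = v)) => [|i u v _ <-]; first exact: bl0.
  by rewrite bl.
apply: eq_bigr => i _.
transitivity (v2r x 0 i *: \sum_j v2r y 0 j *: b (base_vec i) (base_vec j)).
  congr (_ *: _); rewrite {1}[y]base_vec_sum.
  apply: (big_rec2 (fun u v => b (base_vec i) u = v)) => [|j u v _ <-].
    exact: br0.
  by rewrite br.
by rewrite scaler_sumr; apply: eq_bigr => j _; rewrite scalerA.
Qed.

Lemma bil_mxE M N T (b : M -> N -> T) x y : is_bilinear b ->
  v2r (b x y) = krow (v2r x) (v2r y) *m bil_mx b.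
Proof.
move=> /bilinear_sum ->; rewrite frow_fstack pair_bigA linear_sum.
by apply: eq_bigr => h _; rewrite linearZ.
Qed.

Lemma form_mxE M N (e : M -> N -> R) x y : is_bilinear (e : M -> N -> R^o) ->
  e x y = (v2r x *m form_mx e *m (v2r y)^T) 0 0.
Proof.
move=> /bilinear_sum E; rewrite (E x y) -mulmxA mxE; apply: eq_bigr => i _.
rewrite mxE mulr_sumr; apply: eq_bigr => j _.
by rewrite !mxE mulrA mulrAC.
Qed.

Section BaseChangeMatrices.
Variables (S : comNzRingType) (h : R -> S).

Lemma bc_linE M N (f : M -> N) x : bc_lin h f x = x *m map_mx h (hom_mx f).
Proof.
rewrite mulmx_sum_row; apply: eq_bigr => i _; congr (_ *: _).
by rewrite -map_row rowK.
Qed.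

Lemma map_fstack (I : finType) n (s : I -> 'rV[R]_n) :
  map_mx h (fstack s) = fstack (fun x => map_mx h (s x)).
Proof. by apply/matrixP => i j; rewrite !mxE. Qed.

Lemma bc_bilinE M N T (b : M -> N -> T) x y :
  bc_bilin h b x y = krow x y *m map_mx h (bil_mx b).
Proof. by rewrite map_fstack frow_fstack /bc_bilin pair_bigA. Qed.

Lemma bc_formE M N (e : M -> N -> R) x y :
  bc_form h e x y = (x *m map_mx h (form_mx e) *m y^T) 0 0.
Proof.
rewrite -mulmxA mxE; apply: eq_bigr => i _; rewrite mxE mulr_sumr.
by apply: eq_bigr => j _; rewrite !mxE mulrA mulrAC.
Qed.

Lemma bc_multilinE M T n (s : {ffun 'I_n -> M} -> T) x :
  bc_multilin h s x = trow x *m map_mx h (multi_mx s).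
Proof. by rewrite map_fstack frow_fstack. Qed.

End BaseChangeMatrices.

Definition mx_hom M N (A : 'M[R]_(dim M, dim N)) (x : M) : N := r2v (v2r x *m
  A).

Fact mx_hom_linear M N A : linear (@mx_hom M N A).
Proof. by move=> a x y; rewrite /mx_hom !linearP /= mulmxDl -scalemxAl linearP.
  Qed.

HB.instance Definition _ M N A :=
  GRing.isLinear.Build R M N *:%R (@mx_hom M N A) (@mx_hom_linear M N A).

Lemma v2r_mx_hom M N (A : 'M[R]_(dim M, dim N)) x : v2r (mx_hom A x) = v2r x *m
  A.
Proof. exact: r2vK. Qed.

Lemma mx_hom_eq M N (A A' : 'M[R]_(dim M, dim N)) :
  mx_hom A =1 mx_hom A' -> A = A'.
Proof.
move=> AA; apply/row_matrixP => i; rewrite !rowE.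
by have := congr1 v2r (AA (base_vec i)); rewrite !v2r_mx_hom v2r_base.
Qed.

Lemma factors_uniquely_eq (X : Type) T (P : lmodType R) (s : X -> T) (c : X ->
  P)
    (g g' : {linear T -> P}) : factors_uniquely s c ->
  (forall x, g (s x) = c x) -> (forall x, g' (s x) = c x) -> g =1 g'.
Proof. by move=> [g0 [_ uniq]] gs gs' x; rewrite (uniq g) // (uniq g'). Qed.

(** [G] is the map induced by the Kronecker product of coordinate vectors; one identity holds by
    uniqueness of factorizations, the other on basis vectors. *)
Lemma tensor_mx_inv M N T (b : M -> N -> T) : is_tensor b ->
  exists G, G *m bil_mx b = 1%:M /\ bil_mx b *m G = 1%:M.
Proof.
move=> [bb univ]; pose c (x : M) (y : N) := krow (v2r x) (v2r y).
have bc : is_bilinear c.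
  split=> a x x' y; apply/rowP => h; rewrite !mxE !linearP !mxE.
    by rewrite mulrDl mulrA.
  by rewrite mulrDr mulrCA.
have [g [gb _]] := univ _ c bc.
pose G := \matrix_i g (base_vec i) : 'M_(dim T, #|{: 'I_(dim M) * 'I_(dim N)}|).
have gE y : g y = v2r y *m G.
  rewrite {1}[y]base_vec_sum linear_sum mulmx_sum_row; apply: eq_bigr => i _.
  by rewrite linearZ rowK.
exists G; split.
  apply: mx_hom_eq => y.
  apply: (factors_uniquely_eq (univ _ b bb)) => -[x z] /=; apply: v2r_inj;
    rewrite v2r_mx_hom ?mulmx1 //.
  by rewrite mulmxA -gE (gb (x, z)) bil_mxE.
apply/row_matrixP => h; rewrite row_mul rowK -gE (gb (_, _)) /c !v2r_base.
by rewrite row1; apply/rowP => h'; rewrite !mxE /= -natrM mulnb -xpair_eqE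
  -!surjective_pairing (inj_eq enum_val_inj).
Qed.

Definition mx_form M (w : 'cV[R]_(dim M)) (x : M) : R^o := (v2r x *m w) 0 0.

Fact mx_form_linear M w : linear (@mx_form M w : M -> R^o).
Proof. by move=> a x y; rewrite /mx_form linearP /= mulmxDl -scalemxAl !mxE.
  Qed.

HB.instance Definition _ M w :=
  GRing.isLinear.Build R M R^o *:%R (@mx_form M w) (@mx_form_linear M w).

Lemma dual_mx_inv M D (e : D -> M -> R) : is_dual e ->
  exists C, C *m form_mx e = 1%:M /\ form_mx e *m C = 1%:M.
Proof.
move=> [eb univ].
have dE i : {d | forall x, e d x = v2r x 0 i}.
  apply: cid; have [d [dE _]] := univ (mx_form (delta_mx i 0)); exists d => x.
  rewrite dE /= /mx_form !mxE (bigD1 i) //= mxE !eqxx mulr1 big1 ?addr0 // => j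
    ji.
  by rewrite mxE (negPf ji) mulr0.
pose C := \matrix_i v2r (sval (dE i)).
have Ce : C *m form_mx e = 1%:M.
  apply/matrixP => i j; rewrite !mxE; have := svalP (dE i) (base_vec j).
  rewrite v2r_base mxE eqxx /= => <-; rewrite form_mxE // v2r_base trmx_delta
    -colE.
  by rewrite [RHS]mxE [RHS]mxE; apply: eq_bigr => l _; rewrite !mxE.
exists C; split=> //; apply/row_matrixP => l; rewrite rowE [RHS]rowE mulmx1.
(* Vectors with the same image under [form_mx e] represent the same linear form, so they coincide by
   uniqueness. *)
pose w : 'cV_(dim M) := (delta_mx 0 l *m form_mx e)^T.
have [d [_ uniq]] := univ (mx_form w).
have eqd v : v *m form_mx e = delta_mx 0 l *m form_mx e -> r2v v = d.
  move=> vE; apply: uniq => x; rewrite form_mxE // r2vK vE /= /mx_form.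
  by rewrite -[in RHS](trmxK (v2r x)) -trmx_mul [RHS]mxE.
apply: (can_inj r2vK); rewrite (eqd (delta_mx 0 l)) // (eqd (_ *m (_ *m _))) //.
by rewrite -!mulmxA Ce mulmx1.
Qed.

(** Since [M3] is free, lifting its basis gives a section [s]; then [1 - G *m s] lands in the kernel
    of [g], and lifting it through [f] gives [r]. *)
Lemma exact_mx_split M1 M2 M3 (f : {linear M1 -> M2}) (g : {linear M2 -> M3}) :
  short_exact setT setT setT f g -> exists r s,
  [/\ hom_mx f *m r = 1%:M, s *m hom_mx g = 1%:M, hom_mx f *m hom_mx g = 0,
      s *m r = 0 & r *m hom_mx f + hom_mx g *m s = 1%:M].
Proof.
move=> [_ _ injf kerg surjg]; set F := hom_mx f; set G := hom_mx g.
have F0 m (A : 'M_(m, _)) : A *m F = 0 -> A = 0.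
  move=> AF; apply/row_matrixP => i; rewrite row0 -[row i A]r2vK.
  rewrite (injf (r2v (row i A))) ?linear0 //; apply: v2r_inj.
  by rewrite hom_mxE r2vK -row_mul AF row0 linear0.
have /boolp.choice [y yE] : forall l : 'I_(dim M3), exists y, g y = base_vec l.
  by move=> l; have [y [_ yl]] := surjg (base_vec l) I; exists y.
pose s := \matrix_l v2r (y l).
have sG : s *m G = 1%:M.
  by apply/row_matrixP => l; rewrite row_mul rowK -hom_mxE yE v2r_base row1.
have FG : F *m G = 0.
  apply/row_matrixP => i; rewrite row_mul rowK -hom_mxE row0.
  by rewrite ((kerg _ I).2 _) ?linear0 //; exists (base_vec i).
have /boolp.choice [x xE] : forall i, exists x, v2r (f x) = row i (1%:M - G *m
  s).
  move=> i; have [|x [_ xE]] := (kerg (r2v (row i (1%:M - G *m s))) I).1.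
    apply: v2r_inj; rewrite hom_mxE r2vK -row_mul mulmxBl mul1mx -mulmxA sG
      mulmx1.
    by rewrite subrr row0 linear0.
  by exists x; rewrite xE r2vK.
pose r := \matrix_i v2r (x i).
have rF : r *m F = 1%:M - G *m s.
  by apply/row_matrixP => i; rewrite row_mul rowK -hom_mxE xE.
exists r, s; split=> //.
- apply/subr0_eq/F0; rewrite mulmxBl -mulmxA rF mulmxBr mulmx1 mulmxA FG mul0mx.
  by rewrite subr0 mul1mx subrr.
- by apply: F0; rewrite -mulmxA rF mulmxBr mulmx1 mulmxA sG mul1mx subrr.
- by rewrite rF subrK.
Qed.

(** * Multilinear maps, symmetrizers, symmetric and exterior powers *)

Section Multilinear.
Variables (n : nat) (M : vectType R).

Lemma trow_multilin (x : 'I_n -> 'rV[R]_(dim M)) i a u v :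
  let upd w j := if j == i then w else x j in
  trow (upd (a *: u + v)) = a *: trow (upd u) + trow (upd v).
Proof.
have E w (h : {ffun 'I_n -> 'I_(dim M)}) :
    \prod_j (if j == i then w else x j) 0 (h j) =
    w 0 (h i) * \prod_(j | j != i) x j 0 (h j).
  rewrite (bigD1 i) //= eqxx; congr (_ * _).
  by apply: eq_bigr => j /negPf ->.
apply/rowP => h; rewrite [LHS]mxE [RHS]mxE [X in _ = X + _]mxE.
by rewrite ![trow _ 0 h]mxE !E !mxE mulrDl mulrA.
Qed.

Definition vcoord (x : {ffun 'I_n -> M}) (j : 'I_n) := v2r (x j).

Lemma trow_upd (x : {ffun 'I_n -> M}) i a u v :
  let upd w := [ffun j => if j == i then w else x j] in
  trow (vcoord (upd (a *: u + v))) =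
  a *: trow (vcoord (upd u)) + trow (vcoord (upd v)).
Proof.
have E w : trow (vcoord [ffun j => if j == i then w else x j]) =
    trow (fun j => if j == i then v2r w else v2r (x j)).
  by apply: eq_frow => h; apply: eq_bigr => j _; rewrite /vcoord ffunE; case:
    eqP.
by rewrite /= !E linearP trow_multilin.
Qed.

(* By expanding one coordinate at a time. *)
Lemma multilin_eq0 (P : lmodType R) (d : {ffun 'I_n -> M} -> P) :
  is_multilinear d ->
  (forall h : {ffun 'I_n -> 'I_(dim M)}, d [ffun j => base_vec (h j)] = 0) ->
  forall x, d x = 0.
Proof.
move=> dl d0 x.
suff H l (y : {ffun 'I_n -> M}) : (forall j : 'I_n, (l <= j)%N ->
    exists i, y j = base_vec i) -> d y = 0.
  by apply: (H n) => j; rewrite leqNgt ltn_ord.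
elim: l y => [|l IHl] y yl.
  have /boolp.choice [h hE] : forall j, exists i, y j = base_vec i by move=> j;
    exact: yl.
  by rewrite -(d0 [ffun j => h j]); congr d; apply/ffunP => j; rewrite !ffunE.
have [nl|ln] := leqP n l.
  by apply: IHl => j lj; have := leq_trans nl lj; rewrite leqNgt ltn_ord.
pose i := Ordinal ln; pose upd w := [ffun j => if j == i then w else y j].
have updl a u v : d (upd (a *: u + v)) = a *: d (upd u) + d (upd v) by exact:
  dl.
have upd0 : d (upd 0) = 0.
  by have /esym/eqP := updl 1 0 0; rewrite !scale1r addr0 -subr_eq0 addrK =>
    /eqP.
have -> : y = upd (y i) by apply/ffunP => j; rewrite ffunE; case: eqP => [->|].
rewrite [y i]base_vec_sum; elim/big_rec: _ => [//|k u _ du].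
rewrite updl du addr0 IHl ?scaler0 // => j lj; rewrite ffunE.
case: eqVneq => [_|ji]; first by exists k.
by apply: yl; rewrite ltn_neqAle lj andbT; apply: contraNneq ji => lj';
  apply/eqP/val_inj.
Qed.

Lemma vcoord_base (h : {ffun 'I_n -> 'I_(dim M)}) :
  trow (vcoord [ffun j => base_vec (h j)]) = delta_mx 0 (enum_rank h).
Proof.
apply/rowP => a; rewrite !mxE /= [a == _]eq_sym (can2_eq (@enum_rankK _)
  (@enum_valK _)) -prod_nat_eq.
by apply: eq_bigr => j _; rewrite /vcoord ffunE v2r_base mxE eqxx /= eq_sym.
Qed.

Lemma multi_mxE T (s : {ffun 'I_n -> M} -> T) x : is_multilinear s ->
  v2r (s x) = trow (vcoord x) *m multi_mx s.
Proof.
move=> sl; pose d x := v2r (s x) - trow (vcoord x) *m multi_mx s.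
apply/subr0_eq/(@multilin_eq0 _ d) => [y i a u v|h].
  rewrite /d sl trow_upd mulmxDl -scalemxAl linearP /=.
  by rewrite scalerBr opprD addrACA.
by rewrite /d vcoord_base -rowE rowK enum_rankK subrr.
Qed.

Lemma trow_tperm_pow (x : 'I_n -> 'rV[R]_(dim M)) (w : {perm 'I_n}) :
  trow x *m tperm_pow R (dim M) w = trow (fun j => x (w j)).
Proof.
rewrite frow_fmx; apply: eq_frow => h.
rewrite (bigD1 [ffun j => h ((w^-1)%g j)]) //= [X in _ + X]big1 ?addr0; last
  first.
  move=> z zy; case: eqP => [hE|_]; last by rewrite mulr0.
  by case/eqP: zy; apply/ffunP => j; rewrite -hE !ffunE permKV.
rewrite (_ : [ffun j => _] == h); last by apply/eqP/ffunP => j; rewrite !ffunE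
  permK.
rewrite mulr1 (reindex_inj (@perm_inj _ w)) /=.
by apply: eq_bigr => j _; rewrite ffunE permK.
Qed.

(* [n!] times the projector onto the symmetric (resp. antisymmetric) tensors. *)
Definition symmetrizer (alt : bool) m : 'M[R]_#|{: {ffun 'I_n -> 'I_m}}| :=
  \sum_(w : {perm 'I_n}) (-1) ^+ (alt && odd_perm w) *: tperm_pow R m w.

Definition is_eps_symmetric (alt : bool) (P : lmodType R) (s : {ffun 'I_n -> M}
  -> P) :=
  if alt then is_alternating s else is_symmetric s.

(** For a transposition, put [y i + y j] in both slots and expand; the general case follows by
    writing [w] as a product of transpositions. *)
Lemma alternating_sign (P : lmodType R) (s : {ffun 'I_n -> M} -> P)
    (x : {ffun 'I_n -> M}) (w : {perm 'I_n}) :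
  is_multilinear s -> is_alternating s ->
  s [ffun i => x (w i)] = (-1) ^+ odd_perm w *: s x.
Proof.
move=> sl sa.
have swap (y : {ffun 'I_n -> M}) i j : i != j ->
    s [ffun l => y (tperm i j l)] = - s y.
  move=> ij; pose S u v := s [ffun l => if l == j then v else
    [ffun l => if l == i then u else y l] l].
  have Sl u v v' : S u (v + v') = S u v + S u v'.
    have := sl [ffun l => if l == i then u else y l] j 1 v v'.
    by rewrite /= !scale1r; apply.
  have Sr u u' v : S (u + u') v = S u v + S u' v.
    have E t : S t v = s [ffun l => if l == i then t else
        [ffun l => if l == j then v else y l] l].
      congr s; apply/ffunP => l; rewrite !ffunE.
      by case: (eqVneq l j) => // ->; rewrite eq_sym (negPf ij).
    have := sl [ffun l => if l == j then v else y l] i 1 u u'.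
    by rewrite !E /= !scale1r; apply.
  have S0 u : S u u = 0.
    by apply: (sa _ i j ij); rewrite !ffunE eqxx (negPf ij) eqxx.
  have := S0 (y i + y j); rewrite Sl !Sr !S0 add0r addr0.
  have -> : S (y i) (y j) = s y.
    congr s; apply/ffunP => l; rewrite !ffunE.
    by case: (eqVneq l j) => [->//|]; case: (eqVneq l i) => [->|].
  have -> : S (y j) (y i) = s [ffun l => y (tperm i j l)].
    congr s; apply/ffunP => l; rewrite !ffunE; case: tpermP => [->|->|].
    - by rewrite (negPf ij) eqxx.
    - by rewrite eqxx.
    - by move=> /eqP/negPf -> /eqP/negPf ->.
  by move=> /eqP; rewrite addr_eq0 => /eqP.
have [ts -> dts] := prod_tpermP w.
elim: ts dts => [_|[i j] ts IHts /= /andP[ij dts]].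
  by rewrite big_nil odd_perm1 expr0 scale1r; congr s; apply/ffunP => l;
    rewrite ffunE perm1.
rewrite big_cons odd_mul_tperm ij /= signrN scaleNr.
pose y := [ffun l => x ((\prod_(t <- ts) tperm t.1 t.2)%g l)].
have -> : [ffun l => x ((tperm i j * \prod_(t <- ts) tperm t.1 t.2)%g l)] =
    [ffun l => y (tperm i j l)] by apply/ffunP => l; rewrite !ffunE permM.
by rewrite swap // IHts.
Qed.

Lemma tperm_pow_multi (alt : bool) T (s : {ffun 'I_n -> M} -> T) (w : {perm
  'I_n}) :
  is_multilinear s -> is_eps_symmetric alt s ->
  tperm_pow R (dim M) w *m multi_mx s = (-1) ^+ (alt && odd_perm w) *: multi_mx
    s.
Proof.
move=> sl se; apply/row_matrixP => a; rewrite row_mul row_fmx frow_fstack.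
rewrite linearZ /= rowK (bigD1 [ffun j => enum_val a (w j)]) //= eqxx scale1r.
rewrite big1 ?addr0; last by move=> z; rewrite eq_sym => /negPf ->; rewrite
  scale0r.
pose e := [ffun j => base_vec (enum_val a j)] : {ffun 'I_n -> M}.
rewrite -linearZ -[s [ffun j => base_vec (enum_val a j)]]/(s e).
have -> : [ffun j => base_vec ([ffun j => enum_val a (w j)] j)] = [ffun j => e
  (w j)].
  by apply/ffunP => j; rewrite !ffunE.
congr v2r; case: alt se => /= se; first exact: alternating_sign.
by rewrite scale1r; apply: se.
Qed.

Lemma symmetrizer_multi (alt : bool) T (s : {ffun 'I_n -> M} -> T) :
  is_multilinear s -> is_eps_symmetric alt s ->
  symmetrizer alt (dim M) *m multi_mx s = n`!%:R *: multi_mx s.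
Proof.
move=> sl se; rewrite mulmx_suml.
under eq_bigr do rewrite -scalemxAl (tperm_pow_multi _ sl se) scalerA -expr2
  sqrr_sign scale1r.
by rewrite sumr_const scaler_nat card_Sn.
Qed.

Definition symmetrization (alt : bool) (x : {ffun 'I_n -> M}) :=
  trow (vcoord x) *m symmetrizer alt (dim M).

Lemma symmetrization_multilin alt : is_multilinear (symmetrization alt).
Proof.
by move=> x i a u v; rewrite /symmetrization trow_upd mulmxDl -scalemxAl.
Qed.

(** In the alternating case each coordinate is a determinant, which vanishes when two arguments
    agree, without any division by 2; in the symmetric case the sum is reindexed. *)
Lemma symmetrization_eps alt : is_eps_symmetric alt (symmetrization alt).
Proof.
case: alt => [x i j ij xij|x w]; rewrite /symmetrization mulmx_sumr.
  under eq_bigr do rewrite -scalemxAr trow_tperm_pow.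
  apply/rowP => h; rewrite summxE mxE.
  pose A := \matrix_(l < n, l' < n) vcoord x l' 0 (enum_val h l).
  transitivity (\det A).
    by apply: eq_bigr => w _; rewrite !mxE; congr (_ * _); apply: eq_bigr => l
      _; rewrite mxE.
  rewrite -det_tr (determinant_alternate ij) // => l.
  by rewrite !mxE /vcoord xij.
rewrite [RHS]mulmx_sumr (reindex_inj (mulIg (w^-1)%g)) /=.
apply: eq_bigr => v _; rewrite !scale1r !trow_tperm_pow.
by apply: eq_frow => h; apply: eq_bigr => j _; rewrite /vcoord ffunE permM
  permKV.
Qed.

Definition is_eps_power alt T (s : {ffun 'I_n -> M} -> T) :=
  if alt then is_ext_power s else is_sym_power s.

(** [G] is induced by the symmetrization through the universal property. Composed with [s] it
    multiplies by [n!], since both maps factor [n!] times [s]. *)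
Lemma power_mx_inv (alt : bool) T (s : {ffun 'I_n -> M} -> T) :
  is_eps_power alt s -> exists G, G *m multi_mx s = n`!%:R%:M /\
    multi_mx s *m G = symmetrizer alt (dim M).
Proof.
move=> sp.
have [sl se univ] : [/\ is_multilinear s, is_eps_symmetric alt s
    & forall (P : lmodType R) (c : {ffun 'I_n -> M} -> P),
        is_multilinear c -> is_eps_symmetric alt c -> factors_uniquely s c].
  by case: alt sp => -[].
have fc := univ _ _ (symmetrization_multilin alt) (@symmetrization_eps alt).
have [g [gb _]] := fc.
pose G := \matrix_i g (base_vec i) : 'M_(dim T, #|{: {ffun 'I_n -> 'I_(dim
  M)}}|).
have gE y : g y = v2r y *m G.
  rewrite {1}[y]base_vec_sum linear_sum mulmx_sum_row; apply: eq_bigr => i _.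
  by rewrite linearZ rowK.
exists G; split; last first.
  apply/row_matrixP => h; rewrite row_mul rowK -gE gb /symmetrization
    vcoord_base.
  by rewrite enum_valK -rowE.
apply: mx_hom_eq => y.
pose c := (n`!%:R : R) \*: s.
have cl : is_multilinear c.
  by move=> x i a u v; rewrite /c /= sl scalerDr !scalerA mulrC.
have ce : is_eps_symmetric alt c.
  case: alt se {sp univ fc g gb G gE} => /= se.
    by move=> x i j ij xij; rewrite /c /= (se _ _ _ ij xij) scaler0.
  by move=> x w; rewrite /c /= se.
apply: (factors_uniquely_eq (univ _ c cl ce)) => x; apply: v2r_inj;
  rewrite v2r_mx_hom /c /= linearZ /=; last by rewrite mul_mx_scalar.
rewrite mulmxA -gE gb -mulmxA symmetrizer_multi // -scalemxAr.
by rewrite multi_mxE.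
Qed.

End Multilinear.
End VectTypeMatrices.
(** * Arithmetic of A and of A[1/pi] *)

Lemma exp_lt_eps (RR : realType) (x e : RR) : 0 <= x < 1 -> 0 < e ->
  exists n, x ^+ n < e.
Proof.
move=> /andP[x0 x1] e0; move: x0; rewrite le_eqVlt => /predU1P[<-|x0].
  by exists 1%N; rewrite expr1.
pose h := x^-1 - 1; have h0 : 0 < h by rewrite subr_gt0 invf_gt1.
have xE : x^-1 = 1 + h by rewrite addrC subrK.
have bern n : 1 + h *+ n <= x^-1 ^+ n.
  rewrite xE; elim: n => [|n IHn]; first by rewrite mulr0n addr0 expr0.
  rewrite exprS mulrDl mul1r mulrSr addrA lerD //.
  apply: le_trans (_ : h * 1 <= _); first by rewrite mulr1.
  by rewrite ler_pM2l // (le_trans _ IHn) // lerDl mulrn_wge0 // ltW.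
exists (Num.bound (e^-1 / h)); set n := Num.bound _.
have : e^-1 < x^-1 ^+ n.
  apply: lt_le_trans (bern n); rewrite -mulr_natl.
  have : e^-1 / h < n%:R.
    by apply: archi_boundP; rewrite mulr_ge0 // ?invr_ge0 ?ltW // invr_gt0.
  by rewrite ltr_pdivrMr // => /lt_le_trans; apply; rewrite lerDr ler01.
by rewrite exprVn ltf_pV2 ?posrE ?exprn_gt0.
Qed.

Section AbsoluteValues.
Variables (RR : realType) (K : fieldType) (v : absval RR K).

Lemma avX x n : v (x ^+ n) = v x ^+ n.
Proof. by elim: n => [|n IHn]; rewrite ?av_1 // !exprS av_M IHn. Qed.

Lemma av_gt0 x : x != 0 -> 0 < v x.
Proof. by move=> x0; rewrite lt_def av_ge0 andbT; apply: contraNneq x0 =>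
  /av_eq0 ->. Qed.

Lemma av_div x y : y != 0 -> v (x / y) = v x / v y.
Proof.
move=> y0; have vy := lt0r_neq0 (av_gt0 y0).
by apply: (mulIf vy); rewrite divfK // -av_M divfK.
Qed.

Lemma valring_le1 (x : valring v) : v (valring_val x) <= 1.
Proof. by case: x. Qed.

Lemma valring_dvd (x y : valring v) : v (valring_val y) <= v (valring_val x) ->
  exists z, y = x * z.
Proof.
have [x0|x0] := eqVneq (valring_val x) 0.
  rewrite x0 av_0 => vy; exists 0; rewrite mulr0; apply: val_inj; apply:
    (@av_eq0 _ _ v).
  by apply/le_anti; rewrite vy av_ge0.
move=> yx; have z1 : av_int v (valring_val y / valring_val x).
  by rewrite /av_int av_div // ler_pdivrMr ?mul1r // av_gt0.
by exists (ValRing z1); apply: val_inj; rewrite rmorphM /= mulrC divfK.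
Qed.

Lemma valring_mulf_eq0 (x y : valring v) : x * y = 0 -> x = 0 \/ y = 0.
Proof.
move=> /(congr1 val); rewrite rmorphM rmorph0 => /eqP; rewrite mulf_eq0.
by case/orP => /eqP x0; [left|right]; apply: val_inj; rewrite x0 rmorph0.
Qed.

End AbsoluteValues.

Section Ainf.
Variables (RR : realType) (E : local_field RR) (K : perfectoid_ext E).
Variables (Kf : tilt K) (A : ainf Kf).

Local Notation pi := (ai_struct A (lf_pi E)).
Local Notation absE x := (lf_abs E (valring_val x)).

Lemma lf_pi_lt1 : absE (lf_pi E) < 1.
Proof. by apply/(lf_piP (lf_pi E)); exists 1; rewrite mulr1. Qed.

Lemma lf_pi_gt0 : 0 < absE (lf_pi E).
Proof.
apply/av_gt0/eqP => pi0; have := lf_pi_neq0 E; rewrite -(inj_eq val_inj).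
by rewrite rmorph0 /= pi0 eqxx.
Qed.

Lemma ai_factor (a : A) : a != 0 -> exists n c, a = pi ^+ n * c /\ ai_red A c
  != 0.
Proof.
move=> aN0; pose Q n := `[< ~ exists c, a = pi ^+ n * c >].
have exQ : exists n, Q n.
  apply: contrapT => nQ; have [sep _] := ai_complete A.
  move/eqP: aN0; apply; apply: sep => n; apply: contrapT => nc.
  by apply: nQ; exists n; apply/asboolP.
case: (ex_minnP exQ) => -[|n] /asboolP nc minn.
  by case: nc; exists a; rewrite expr0 mul1r.
have /asboolP/contrapT [c ac] : ~~ Q n by apply/negP => /minn; rewrite ltnn.
exists n, c; split=> //; apply/eqP => /(ai_redP A).2 [d cd].
by apply: nc; exists d; rewrite ac cd exprSr mulrA.
Qed.

Lemma ai_piX_reg n (a : A) : pi ^+ n * a = 0 -> a = 0.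
Proof.
elim: n => [|n IHn]; first by rewrite expr0 mul1r.
by rewrite exprS -mulrA => /ai_torsion_free.
Qed.

(** Powers of [pi] are extracted and cancelled, which reduces to the integrality of the residue
    ring, a valuation ring. *)
Lemma ai_mulf_eq0 (a b : A) : a * b = 0 -> a = 0 \/ b = 0.
Proof.
move=> ab; have [->|/ai_factor [m [c [aE rc]]]] := eqVneq a 0; first by left.
have [->|/ai_factor [n [d [bE rd]]]] := eqVneq b 0; first by right.
have : c * d = 0.
  by apply: (@ai_piX_reg (m + n)); rewrite exprD mulrACA -aE -bE.
move=> /(congr1 (ai_red A)); rewrite rmorphM rmorph0 => /valring_mulf_eq0.
by case=> /eqP; [rewrite (negPf rc)|rewrite (negPf rd)].
Qed.

(* Otherwise [A] would be isomorphic to O_K, but A/pi is reduced and O_K/pi is *)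
(* not, as the valuation of [K] is not discrete.                               *)
Lemma ai_xi_neq0 : ai_xi A != 0.
Proof.
apply/eqP => xi0.
have th_inj a : ai_theta A a = 0 -> a = 0.
  by move=> /(ai_xiP A).2 [c]; rewrite xi0 mul0r.
have thpi : pe_abs K (valring_val (ai_theta A pi)) = absE (lf_pi E).
  by rewrite ai_theta_struct pe_abs_ext.
have [_ /(_ _ lf_pi_lt1) [x /andP[pix x1]] _ _] := pe_perfectoid K.
have x_int : av_int (pe_abs K) x by rewrite /av_int ltW.
have [a aE] := (ai_xiP A).1 (ValRing x_int).
have [n xn] : exists n, pe_abs K x ^+ n < absE (lf_pi E).
  by apply: exp_lt_eps lf_pi_gt0; rewrite av_ge0.
have [|y yE] := @valring_dvd _ _ (pe_abs K) (ai_theta A pi) (ai_theta A a ^+ n).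
  by rewrite thpi -[valring_val _]/(val _) rmorphXn avX aE /= ltW.
have [b bE] := (ai_xiP A).1 y.
have aEb : a ^+ n = pi * b.
  by apply/subr0_eq/th_inj; rewrite rmorphB rmorphXn yE rmorphM bE subrr.
have ra m : ai_red A a ^+ m = 0 -> ai_red A a = 0.
  elim: m => [/eqP|m IHm]; first by rewrite expr0 oner_eq0.
  by rewrite exprS => /valring_mulf_eq0 [].
have /(ra n)/(ai_redP A).2 [c cE] : ai_red A a ^+ n = 0.
  by rewrite -rmorphXn; apply/(ai_redP A).2; exists b.
have : pe_abs K x <= absE (lf_pi E).
  rewrite -[x]/(valring_val (ValRing x_int)) -aE cE rmorphM.
  rewrite -[valring_val _]/(val _) rmorphM av_M /= thpi.
  by rewrite ler_piMr ?valring_le1 // av_ge0.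
by rewrite leNgt pix.
Qed.

(** A positive integer has positive absolute value in [E], so some power of the uniformizer is
    smaller, hence divisible by it. *)
Lemma lf_natr_dvd n : (0 < n)%N ->
  exists m (y : valring (lf_abs E)), lf_pi E ^+ m = n%:R * y.
Proof.
move=> n0; have [vQ _ _] := lf_QpP E.
have vn : 0 < absE (n%:R : valring (lf_abs E)).
  rewrite -[valring_val _]/(val _) rmorph_nat -scaler_nat lf_abs_ext vQ //.
  by rewrite invr_gt0 exprn_gt0 // ltr0n prime_gt0 // lf_p_prime.
have [m mn] : exists m, absE (lf_pi E) ^+ m < absE (n%:R : valring (lf_abs E)).
  by apply: exp_lt_eps vn; rewrite ltW ?lf_pi_gt0 ?lf_pi_lt1.
have [|y yE] := @valring_dvd _ _ (lf_abs E) n%:R (lf_pi E ^+ m); last by exists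
  m, y.
by rewrite -[valring_val (_ ^+ m)]/(val _) rmorphXn avX ltW.
Qed.

End Ainf.

Section BKRings.
Variables (RR : realType) (E : local_field RR) (K : perfectoid_ext E).
Variables (Kf : tilt K) (A : ainf Kf) (S : bk_rings A).

Local Notation piA := (ai_struct A (lf_pi E)).
Local Notation iR := (bk_to_R S).

Lemma bk_to_R_eq0 a : iR a = 0 -> a = 0.
Proof.
have [_ _ inj] := bk_RP S; move=> /inj [_ [[n ->]]].
exact: ai_piX_reg.
Qed.

Lemma bk_frac (x : S) : exists a n, x = iR a / iR (piA ^+ n) /\
  iR (piA ^+ n) \is a GRing.unit.
Proof.
have [unit ex _] := bk_RP S; have [a [_ [[n ->] xE]]] := ex x.
by exists a, n; split=> //; apply: unit; exists n.
Qed.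

Lemma bk_mulf_eq0 (x y : S) : x * y = 0 -> x = 0 \/ y = 0.
Proof.
have [a [m [xE um]]] := bk_frac x; have [b [n [yE un]]] := bk_frac y.
move=> xy; have /bk_to_R_eq0/ai_mulf_eq0 : iR (a * b) = 0.
  rewrite rmorphM -[iR a](divrK um) -[iR b](divrK un) -xE -yE.
  by rewrite mulrACA xy mul0r.
by case=> ab0; [left; rewrite xE|right; rewrite yE]; rewrite ab0 rmorph0 mul0r.
Qed.

Lemma bk_natr_unit n : (0 < n)%N -> (n%:R : S) \is a GRing.unit.
Proof.
move=> /(lf_natr_dvd E) [m [y]] /(congr1 (iR \o ai_struct A)) /=.
rewrite !rmorphM !rmorphXn !rmorph_nat => mE.
have [unit _ _] := bk_RP S.
have : iR (piA ^+ m) \is a GRing.unit by apply: unit; exists m.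
by rewrite rmorphXn mE unitrM => /andP[].
Qed.

(** The Frobenius of [A] is bijective and fixes the uniformizer, so its inverse extends to
    fractions. *)
Lemma bk_phi_inv : exists psi : {rmorphism S -> S},
  cancel (bk_phi S) psi /\ cancel psi (bk_phi S).
Proof.
have phi_pi n : bk_phi S (iR (piA ^+ n)) = iR (piA ^+ n).
  by rewrite bk_phiE rmorphXn ai_phi_struct.
have phi0 x : bk_phi S x = 0 -> x = 0.
  have [a [n [xE un]]] := bk_frac x; rewrite xE rmorphM rmorphV // phi_pi
    bk_phiE.
  move=> /(congr1 ( *%R^~ (iR (piA ^+ n)))); rewrite mul0r divrK // =>
    /bk_to_R_eq0.
  rewrite -[RHS](rmorph0 (ai_phi A)) => /(bij_inj (ai_phi_bij A)) ->.
  by rewrite rmorph0 mul0r.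
have phi_inj : injective (bk_phi S).
  by move=> x y xy; apply/subr0_eq/phi0; rewrite rmorphB xy subrr.
have /boolp.choice [psi psiK] : forall y, exists x, bk_phi S x = y.
  move=> y; have [a [n [yE un]]] := bk_frac y; have [f fK Kf'] := ai_phi_bij A.
  exists (iR (f a) / iR (piA ^+ n)).
  by rewrite rmorphM rmorphV // phi_pi bk_phiE Kf' -yE.
have phiK : cancel (bk_phi S) psi by move=> x; apply: phi_inj; rewrite psiK.
pose a1 := GRing.isZmodMorphism.Build S S psi (can2_zmod_morphism phiK psiK).
pose a2 := GRing.isMonoidMorphism.Build S S psi (can2_monoid_morphism phiK
  psiK).
by exists (HB.pack psi a1 a2 : {rmorphism S -> S}).
Qed.

Lemma bk_xi_neq0 : iR (ai_xi A) != 0.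
Proof. by apply/eqP => /bk_to_R_eq0 /eqP; rewrite (negPf (ai_xi_neq0 A)). Qed.

Lemma bk_xi'_neq0 : iR (ai_phi A (ai_xi A)) != 0.
Proof.
apply/eqP => /bk_to_R_eq0; rewrite -[RHS](rmorph0 (ai_phi A)).
by move=> /(bij_inj (ai_phi_bij A)) /eqP; rewrite (negPf (ai_xi_neq0 A)).
Qed.

(** If the uniformizer were zero, the completion axioms would make [u] a multiple of its square in
    the local ring. Clearing denominators in the domain [S] makes some denominator a multiple of
    [u], which is excluded. *)
Lemma dr_unif_neq0 (u : S) (k : fieldType) (th : {rmorphism S -> k})
  (B : dR_ring u th) : u != 0 -> dr_unif B != 0.
Proof.
move=> u0; apply/eqP => pi0; have [_ _ inj] := dr_complP B.
have [|c cE] := inj 2%N (dr_to_loc B u).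
  by exists 0; rewrite mulr0 -[LHS]/(dr_unif B) pi0.
have [unit frac ker] := dr_locP B; have [a [s [sS cas]]] := frac c.
have us := unit s sS.
have /ker [t [tS]] : dr_to_loc B (u * s - u ^+ 2 * a) = 0.
  rewrite expr2 rmorphB !rmorphM {1}cE cas expr2; apply/eqP; rewrite subr_eq0.
  by rewrite -!mulrA mulVr // mulr1.
rewrite expr2 -mulrA -mulrBr => /bk_mulf_eq0 [t0|/bk_mulf_eq0 [/eqP|su]].
- by apply: tS; exists 0; rewrite mulr0.
- by rewrite (negPf u0).
- by apply: sS; exists a; apply: subr0_eq.
Qed.

End BKRings.
(** * Compatibilities of the Hodge filtrations *)

Lemma split_dim (F : fieldType) n1 n2 n3 (f : 'M[F]_(n1, n2)) (g : 'M[F]_(n2,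
  n3))
    (r : 'M[F]_(n2, n1)) (s : 'M[F]_(n3, n2)) :
  f *m r = 1%:M -> s *m g = 1%:M -> f *m g = 0 -> s *m r = 0 ->
  r *m f + g *m s = 1%:M -> (n1 + n3)%N = n2.
Proof.
move=> fr sg fg sr rf; apply/eqP; rewrite eqn_leq; apply/andP; split.
  apply: (@mulmx1_min _ _ _ (col_mx f s) (row_mx r g)).
  by rewrite mul_col_row fr fg sr sg scalar_mx_block.
by apply: (@mulmx1_min _ _ _ (row_mx r g) (col_mx f s)); rewrite mul_row_col.
Qed.

Lemma is_span_eq (k : fieldType) n (U : {vspace 'rV[k]_n}) (X Y : set 'rV[k]_n)
  :
  (forall x, X x <-> Y x) -> is_span U X -> is_span U Y.
Proof.
move=> XY [XU minU]; split=> [x /XY /XU //|V YV].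
by apply: minU => x /XY /YV.
Qed.

Lemma symmetrizer_tpow (R : comNzRingType) n m alt (P : 'M[R]_m) :
  symmetrizer R n alt m *m tpow n P = tpow n P *m symmetrizer R n alt m.
Proof.
rewrite mulmx_suml mulmx_sumr; apply: eq_bigr => w _.
by rewrite -scalemxAl -scalemxAr tperm_powC.
Qed.

Lemma map_symmetrizer (R S : comNzRingType) (h : {rmorphism R -> S}) n m alt :
  map_mx h (symmetrizer R n alt m) = symmetrizer S n alt m.
Proof.
rewrite map_mx_sum; apply: eq_bigr => w _.
by rewrite map_mxZ map_tperm_pow rmorph_sign.
Qed.

Section HodgeProperties.
Variables (RR : realType) (E : local_field RR) (K : perfectoid_ext E).
Variables (Kf : tilt K) (A : ainf Kf) (S : bk_rings A).
Variables (u : S) (k : fieldType) (th : {rmorphism S -> k}) (B : dR_ring u th).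
Hypothesis u_neq0 : u != 0.
(** The standard lattice is a base change along [i0]; the second one, spanned by the rows of [Q M],
    is a base change along [i1], to be taken as [i0] composed with Frobenius or its inverse. The
    hypotheses say that structure maps respect both lattices. *)
Variables (i1 : {rmorphism S -> B}) (Q : forall M : phimod S, 'M[dr_frac
  B]_(dim M)).

Local Notation i0 := (dr_compl B \o dr_to_loc B).
Local Notation iL := (dr_to_frac B).
Local Notation "A ^0" := (map_mx i0 A) (at level 2, format "A ^0").
Local Notation "A ^1" := (map_mx i1 A) (at level 2, format "A ^1").
Local Notation "A ^L" := (map_mx iL A) (at level 2, format "A ^L").

Hypothesis Q_unit : forall M, Q M \in unitmx.
Hypothesis Q_hom : forall (M N : phimod S) (f : {linear M -> N}), is_phimod_hom
  f ->
  Q M *m (hom_mx f)^0^L = (hom_mx f)^1^L *m Q N.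
Hypothesis Q_tensor : forall (M N T : phimod S) (b : M -> N -> T),
  is_phimod_tensor b ->
  kron (Q M) (Q N) *m (bil_mx b)^0^L = (bil_mx b)^1^L *m Q T.
Hypothesis Q_dual : forall (M D : phimod S) (e : D -> M -> S), is_phimod_dual e
  ->
  Q D *m (form_mx e)^0^L *m (Q M)^T = (form_mx e)^1^L.
Hypothesis Q_multi : forall (M T : phimod S) n (s : {ffun 'I_n -> M} -> T),
  phi_multilin s ->
  tpow n (Q M) *m (multi_mx s)^0^L = (multi_mx s)^1^L *m Q T.

Let pi0 : dr_unif B != 0. Proof. exact: dr_unif_neq0. Qed.

Local Notation F := (fun M : phimod S => lfil (B := B) (Q M)).

Lemma res_map0 m n (X : 'M[S]_(m, n)) : map_mx (dr_res B) X^0 = map_mx th X.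
Proof. by apply/matrixP => i j; rewrite !mxE /= dr_res_th. Qed.

Lemma hodge_functorial : fil_functorial th F.
Proof.
split=> [M|M N f fP i x xi].
  have [a [U [U' aQ]]] := adapted_exists pi0 (Q_unit M).
  exact: (adapted_filtration pi0 aQ).
rewrite bc_linE -res_map0.
exact: lfil_mor (Q_hom fP) xi.
Qed.

Lemma hodge_tensor : fil_compat_tensor th F.
Proof.
move=> M N T b bP i; have [G [Gb bG]] := tensor_mx_inv bP.1.
have [a [U [U' aM]]] := adapted_exists pi0 (Q_unit M).
have [c [W [W' cN]]] := adapted_exists pi0 (Q_unit N).
have Gb0 : G^0 *m (bil_mx b)^0 = 1%:M by rewrite -map_mxM Gb map_mx1.
have Gb1 : G^1 *m (bil_mx b)^1 = 1%:M by rewrite -map_mxM Gb map_mx1.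
have bG0 : (bil_mx b)^0 *m G^0 = 1%:M by rewrite -map_mxM bG map_mx1.
have bG1 : (bil_mx b)^1 *m G^1 = 1%:M by rewrite -map_mxM bG map_mx1.
have res1 : dr_res B 1 != 0 by rewrite rmorph1 oner_neq0.
have Q1 : kron (Q M) (Q N) *m map_mx iL 1%:M = map_mx iL 1%:M *m kron (Q M) (Q
  N).
  by rewrite !map_mx1 mulmx1 mul1mx.
apply: is_span_eq (lfil_retract_span (Q_tensor bP) Gb0 Gb1 res1 bG0 bG1 Q1
  (lfil_kron_span pi0 aM cN i)) => z; split.
  move=> [_ [j1 [j2 [x [y [ij xj yj ->]]]]] ->]; exists j1, j2, x, y; split=>
    //.
  by rewrite bc_bilinE res_map0.
move=> [j1 [j2 [x [y [ij xj yj ->]]]]]; exists (krow x y).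
  by exists j1, j2, x, y.
by rewrite bc_bilinE res_map0.
Qed.

(** Retraction of the tensor power with factor [n!]: the composite endomorphism is the symmetrizer,
    which commutes with [tpow n (Q M)], and [n!] has nonzero residue. *)
Lemma hodge_power alt n (M T : phimod S) (s : {ffun 'I_n -> M} -> T) :
  is_eps_power alt s -> phi_multilin s -> fil_power th F s.
Proof.
move=> sP phis i; have [G [Gs sG]] := power_mx_inv sP.
have [a [U [U' aM]]] := adapted_exists pi0 (Q_unit M).
have Gs0 : G^0 *m (multi_mx s)^0 = (n`!%:R)%:M.
  by rewrite -map_mxM Gs map_scalar_mx rmorph_nat.
have Gs1 : G^1 *m (multi_mx s)^1 = (n`!%:R)%:M.
  by rewrite -map_mxM Gs map_scalar_mx rmorph_nat.
have sG0 : (multi_mx s)^0 *m G^0 = symmetrizer B n alt (dim M).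
  by rewrite -map_mxM sG map_symmetrizer.
have sG1 : (multi_mx s)^1 *m G^1 = symmetrizer B n alt (dim M).
  by rewrite -map_mxM sG map_symmetrizer.
have res_fact : dr_res B n`!%:R != 0.
  rewrite rmorph_nat -(rmorph_nat th) -unitfE rmorph_unit //.
  exact/bk_natr_unit/fact_gt0.
have Qs : tpow n (Q M) *m map_mx iL (symmetrizer B n alt (dim M)) =
    map_mx iL (symmetrizer B n alt (dim M)) *m tpow n (Q M).
  by rewrite map_symmetrizer symmetrizer_tpow.
apply: is_span_eq (lfil_retract_span (Q_multi phis) Gs0 Gs1 res_fact sG0 sG1 Qs
  (lfil_tpow_span pi0 n aM i)) => z; split.
  move=> [_ [j [x [ij xj ->]]] ->]; exists j, x; split=> //.
  by rewrite bc_multilinE res_map0.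
move=> [j [x [ij xj ->]]]; exists (trow x); first by exists j, x.
by rewrite bc_multilinE res_map0.
Qed.

(** The matrix of the pairing identifies the lattice pair of [D] with the dual pair, given by the
    inverse transpose of [Q M]. *)
Lemma hodge_dual : fil_compat_dual th F.
Proof.
move=> M D e eP i x; have [C [Ce eC]] := dual_mx_inv eP.1.
have [a [U [U' aM]]] := adapted_exists pi0 (Q_unit M).
have QMt : (Q M)^T \in unitmx by rewrite unitmx_tr.
have Qe : Q D *m (form_mx e)^0^L = (form_mx e)^1^L *m (invmx (Q M))^T.
  by rewrite -(Q_dual eP) trmx_inv mulmxK.
have QC : (invmx (Q M))^T *m C^0^L = C^1^L *m Q D.
  rewrite -[Q D]mulmx1 -[in RHS](map_mx1 iL) -(map_mx1 i0) -eC !map_mxM.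
  rewrite (mulmxA (Q D)) Qe !mulmxA -map_mxM -map_mxM Ce !map_mx1.
  by rewrite mul1mx.
transitivity (x *m map_mx th (form_mx e) \in lfil (B := B) (invmx (Q M))^T i).
  split=> [|xi]; first by rewrite -res_map0; apply: lfil_mor Qe.
  have := lfil_mor QC xi; rewrite -mulmxA res_map0 -map_mxM eC map_mx1 mulmx1.
  by [].
apply: iff_trans (lfil_dualP pi0 aM _ _) _.
split=> H j y ij yj; first by rewrite bc_formE (H j y) // mxE.
by apply/matrixP => o o'; rewrite !ord1 -bc_formE (H j y) // mxE.
Qed.

Lemma hodge_exact (M1 M2 M3 : phimod S) (f : {linear M1 -> M2}) (g : {linear M2
  -> M3}) :
  is_phimod_exact f g ->
  type_le (dim M2) (type_cat (fil_type (F M1)) (fil_type (F M3))) (fil_type (F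
    M2)) /\
  (type_cat (fil_type (F M1)) (fil_type (F M3)) = fil_type (F M2) <->
   forall i : int, short_exact [set` F M1 i] [set` F M2 i] [set` F M3 i]
                     (bc_lin th f) (bc_lin th g)).
Proof.
move=> [fP gP /exact_mx_split [r [s [fr sg fg sr rf]]]].
have [a1 [U1 [U1' aM1]]] := adapted_exists pi0 (Q_unit M1).
have [a2 [U2 [U2' aM2]]] := adapted_exists pi0 (Q_unit M2).
have [a3 [U3 [U3' aM3]]] := adapted_exists pi0 (Q_unit M3).
have n123 : (dim M1 + dim M3)%N = dim M2.
  apply: (@split_dim k _ _ _ (map_mx th (hom_mx f)) (map_mx th (hom_mx g))
    (map_mx th r) (map_mx th s)); rewrite -?map_mxM ?fr ?sg ?fg ?sr ?map_mx1
      ?map_mx0 //.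
  by rewrite -map_mxD rf map_mx1.
have fr0 : (hom_mx f)^0 *m r^0 = 1%:M by rewrite -map_mxM fr map_mx1.
have sg0 : s^0 *m (hom_mx g)^0 = 1%:M by rewrite -map_mxM sg map_mx1.
have fg0 : (hom_mx f)^0 *m (hom_mx g)^0 = 0 by rewrite -map_mxM fg map_mx0.
have sr0 : s^0 *m r^0 = 0 by rewrite -map_mxM sr map_mx0.
have rf0 : r^0 *m (hom_mx f)^0 + (hom_mx g)^0 *m s^0 = 1%:M.
  by rewrite -!map_mxM -map_mxD rf map_mx1.
have sg1 : s^1 *m (hom_mx g)^1 = 1%:M by rewrite -map_mxM sg map_mx1.
have rf1 : r^1 *m (hom_mx f)^1 + (hom_mx g)^1 *m s^1 = 1%:M.
  by rewrite -!map_mxM -map_mxD rf map_mx1.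
have -> : bc_lin th f = mulmxr (map_mx (dr_res B) (hom_mx f)^0).
  by apply/funext => x; rewrite bc_linE res_map0.
have -> : bc_lin th g = mulmxr (map_mx (dr_res B) (hom_mx g)^0).
  by apply/funext => x; rewrite bc_linE res_map0.
have Qf := Q_hom fP; have Qg := Q_hom gP.
split; first exact: (lfil_exact_type_le pi0 n123 fr0 sg0 fg0 sr0 sg1 rf1 Qf Qg
  aM1 aM2 aM3).
exact: (lfil_exactP pi0 n123 fr0 sg0 fg0 sr0 rf0 sg1 Qf Qg aM1 aM2 aM3).
Qed.

Definition hodge_properties (G : forall M : phimod S, int -> {vspace
  'rV[k]_(dim M)}) :=
  [/\ fil_functorial th G, fil_compat_tensor th G, fil_compat_dual th G,
      fil_compat_sym th G & fil_compat_ext th G] /\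
  (forall (M1 M2 M3 : phimod S) (f : {linear M1 -> M2}) (g : {linear M2 -> M3}),
     is_phimod_exact f g ->
     type_le (dim M2) (type_cat (fil_type (G M1)) (fil_type (G M3)))
                      (fil_type (G M2)) /\
     (type_cat (fil_type (G M1)) (fil_type (G M3)) = fil_type (G M2) <->
      forall i : int,
        short_exact [set` G M1 i] [set` G M2 i] [set` G M3 i]
                    (bc_lin th f) (bc_lin th g))).

Lemma hodge_propertiesP : hodge_properties F.
Proof.
split; last exact: hodge_exact.
split.
- exact: hodge_functorial.
- exact: hodge_tensor.
- exact: hodge_dual.
- by move=> n M T s [sP phis]; apply: (@hodge_power false).
- by move=> n M T s [sP phis]; apply: (@hodge_power true).
Qed.

End HodgeProperties.

(** * From Frobenius modules to lattice pairs over the two period rings *)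

Section PhimodMatrices.
Variables (RR : realType) (E : local_field RR) (K : perfectoid_ext E).
Variables (Kf : tilt K) (A : ainf Kf) (S : bk_rings A).

Local Notation iR := (bk_to_Rx S).
Local Notation iRphi := (fun x : S => bk_to_Rx S (bk_phi S x)).

Lemma mulmx_row_ext (R : comNzRingType) m n (X Y : 'M[R]_(m, n)) :
  (forall x : 'rV_m, x *m X = x *m Y) -> X = Y.
Proof. by move=> XY; apply/row_matrixP => i; rewrite !rowE. Qed.

Lemma phimod_hom_mx (M N : phimod S) (f : {linear M -> N}) : is_phimod_hom f ->
  pm_phi M *m map_mx iR (hom_mx f) = map_mx iRphi (hom_mx f) *m pm_phi N.
Proof.
move=> fP; apply: mulmx_row_ext => x.
by rewrite !mulmxA -!bc_linE fP.
Qed.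

Lemma phimod_tensor_mx (M N T : phimod S) (b : M -> N -> T) : is_phimod_tensor
  b ->
  kron (pm_phi M) (pm_phi N) *m map_mx iR (bil_mx b) =
  map_mx iRphi (bil_mx b) *m pm_phi T.
Proof.
move=> [_ bP]; apply/row_matrixP => a; rewrite !rowE !mulmxA.
have -> : delta_mx 0 a = krow (delta_mx 0 (enum_val a).1) (delta_mx 0 (enum_val
  a).2)
    :> 'rV[bk_Rx S]__.
  apply/rowP => a'; rewrite !mxE /= -natrM mulnb -xpair_eqE.
  by rewrite -!surjective_pairing (inj_eq enum_val_inj).
by rewrite krow_kron -!bc_bilinE bP.
Qed.

Lemma phimod_dual_mx (M D : phimod S) (e : D -> M -> S) : is_phimod_dual e ->
  pm_phi D *m map_mx iR (form_mx e) *m (pm_phi M)^T = map_mx iRphi (form_mx e).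
Proof.
move=> [_ eP]; apply/matrixP => i j.
pose di : 'rV[bk_Rx S]_(dim D) := delta_mx 0 i.
pose dj : 'rV[bk_Rx S]_(dim M) := delta_mx 0 j.
have E0 X : (di *m X *m dj^T) 0 0 = X i j.
  by rewrite /di /dj trmx_delta -colE -rowE !mxE.
rewrite -!E0 -bc_formE -eP bc_formE; congr (fun_of_matrix _ 0 0).
by rewrite trmx_mul !mulmxA.
Qed.

Lemma phimod_multi_mx (M T : phimod S) n (s : {ffun 'I_n -> M} -> T) :
  phi_multilin s ->
  tpow n (pm_phi M) *m map_mx iR (multi_mx s) = map_mx iRphi (multi_mx s) *m
    pm_phi T.
Proof.
move=> sP; apply/row_matrixP => a; rewrite !rowE !mulmxA.
pose x := [ffun j => delta_mx 0 (enum_val a j)] : {ffun 'I_n -> 'rV[bk_Rx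
  S]_(dim M)}.
have -> : delta_mx 0 a = trow x.
  apply/rowP => a'; rewrite !mxE /= -(inj_eq enum_val_inj) -prod_nat_eq.
  by apply: eq_bigr => j _; rewrite /x ffunE mxE [0 == 0]eqxx.
have := sP x; rewrite !bc_multilinE => ->; rewrite trow_tpow; congr (_ *m _).
by apply: eq_frow => h; apply: eq_bigr => j _; rewrite [in RHS]ffunE.
Qed.

Lemma map_pm_phi_unit (F : fieldType) (c : {rmorphism bk_Rx S -> F}) (M :
  phimod S) :
  map_mx c (pm_phi M) \in unitmx.
Proof.
by rewrite unitmxE det_map_mx rmorph_unit // -unitmxE pm_phi_unit.
Qed.

Section BaseChange.
Variables (u : S) (k : fieldType) (th : {rmorphism S -> k}) (B : dR_ring u th).
Hypothesis u_neq0 : u != 0.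
Variables (c : {rmorphism bk_Rx S -> dr_frac B}) (i1 : {rmorphism S -> B}).

Local Notation i0 := (dr_compl B \o dr_to_loc B).
Local Notation iL := (dr_to_frac B).
Local Notation P M := (map_mx c (pm_phi M)).

(** Here the second lattice is the image of the source of Frobenius, so the matrix relations over
    [bk_Rx S] map directly to those required of [Q]. *)
Lemma hodge_properties_source :
  (forall x, c (iR x) = iL (i0 x)) -> (forall x, c (iRphi x) = iL (i1 x)) ->
  hodge_properties th (fun M : phimod S => lfil (B := B) (P M)).
Proof.
move=> c0 c1.
have E0 m n (X : 'M[S]_(m, n)) : map_mx iL (map_mx i0 X) = map_mx c (map_mx iR
  X).
  by apply/matrixP => i j; rewrite !mxE c0.
have E1 m n (X : 'M[S]_(m, n)) : map_mx iL (map_mx i1 X) = map_mx c (map_mx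
  iRphi X).
  by apply/matrixP => i j; rewrite !mxE c1.
apply: (@hodge_propertiesP _ _ _ _ _ _ _ _ _ B u_neq0 i1) => [M|M N f|M N T b|M
  D e|M T n s].
- exact: map_pm_phi_unit.
- by move=> /phimod_hom_mx fP; rewrite E0 E1 -!map_mxM fP.
- by move=> /phimod_tensor_mx bP; rewrite E0 E1 -map_kron -!map_mxM bP.
- by move=> /phimod_dual_mx eP; rewrite E0 E1 map_trmx -!map_mxM eP.
- by move=> /phimod_multi_mx sP; rewrite E0 E1 -map_tpow -!map_mxM sP.
Qed.

(** Here the second lattice is the preimage of the target of Frobenius; the roles of the two base
    changes are exchanged and the relations are inverted. *)
Lemma hodge_properties_target :
  (forall x, c (iRphi x) = iL (i0 x)) -> (forall x, c (iR x) = iL (i1 x)) ->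
  hodge_properties th (fun M : phimod S => lfil (B := B) (invmx (P M))).
Proof.
move=> c0 c1.
have E0 m n (X : 'M[S]_(m, n)) : map_mx iL (map_mx i0 X) = map_mx c (map_mx
  iRphi X).
  by apply/matrixP => i j; rewrite !mxE c0.
have E1 m n (X : 'M[S]_(m, n)) : map_mx iL (map_mx i1 X) = map_mx c (map_mx iR
  X).
  by apply/matrixP => i j; rewrite !mxE c1.
have Pu M : P M \in unitmx by exact: map_pm_phi_unit.
have inv m n (X : 'M[dr_frac B]_m) X' (Y : 'M[dr_frac B]_n) Z Z' :
    X' *m X = 1%:M -> Y \in unitmx -> X *m Z = Z' *m Y -> X' *m Z' = Z *m invmx
      Y.
  move=> XX Yu XZ; rewrite -[X' *m Z'](mulmxK Yu) -(mulmxA X') -XZ mulmxA XX.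
  by rewrite mul1mx.
apply: (@hodge_propertiesP _ _ _ _ _ _ _ _ _ B u_neq0 i1) => [M|M N f|M N T b|M
  D e|M T n s].
- by rewrite unitmx_inv.
- move=> /phimod_hom_mx fP; rewrite E0 E1; apply: inv (mulVmx (Pu M)) (Pu N) _.
  by rewrite -!map_mxM fP.
- move=> /phimod_tensor_mx bP; rewrite E0 E1.
  apply: (inv _ _ (kron (P M) (P N))) (Pu T) _.
    by rewrite kronM !mulVmx // kron1.
  by rewrite -map_kron -!map_mxM bP.
- move=> /phimod_dual_mx eP; rewrite E0 E1 -eP !map_mxM -map_trmx -!mulmxA.
  by rewrite -trmx_mul mulVmx // trmx1 mulmx1 mulKmx.
- move=> /phimod_multi_mx sP; rewrite E0 E1.
  apply: (inv _ _ (tpow n (P M))) (Pu T) _; first by rewrite tpowM mulVmx //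
    tpow1.
  by rewrite -map_tpow -!map_mxM sP.
Qed.

End BaseChange.

Lemma hodge_fil_iotaE (M : phimod S) :
  hodge_fil_iota M = lfil (B := bk_B S) (invmx (map_mx (bk_to_BdR S) (pm_phi
    M))).
Proof.
have Pu := map_pm_phi_unit (bk_to_BdR S) M.
apply/funext => i; rewrite /hodge_fil_iota /lfil; congr (lattice_fil _ i).
apply/seteqP; split=> z [w zw]; exists w; first by rewrite -zw mulmxK.
by rewrite zw mulmxKV.
Qed.

End PhimodMatrices.

Theorem proposition32 (RR : realType) (E : local_field RR)
    (K : perfectoid_ext E) (Kf : tilt K) (A : ainf Kf) (S : bk_rings A) :
  let th' := bk_theta' S in
  let F := @hodge_fil RR E K Kf A S in
  let th := bk_theta S in
  let Fi := @hodge_fil_iota RR E K Kf A S in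
  [/\ fil_functorial th' F, fil_compat_tensor th' F, fil_compat_dual th' F,
      fil_compat_sym th' F & fil_compat_ext th' F] /\
  (forall (M1 M2 M3 : phimod S) (f : {linear M1 -> M2}) (g : {linear M2 -> M3}),
     is_phimod_exact f g ->
     type_le (dim M2) (type_cat (fil_type (F M1)) (fil_type (F M3)))
                      (fil_type (F M2)) /\
     (type_cat (fil_type (F M1)) (fil_type (F M3)) = fil_type (F M2) <->
      forall i : int,
        short_exact [set` F M1 i] [set` F M2 i] [set` F M3 i]
                    (bc_lin th' f) (bc_lin th' g))) /\
  [/\ fil_functorial th Fi, fil_compat_tensor th Fi, fil_compat_dual th Fi,
      fil_compat_sym th Fi & fil_compat_ext th Fi] /\
  (forall (M1 M2 M3 : phimod S) (f : {linear M1 -> M2}) (g : {linear M2 -> M3}),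
     is_phimod_exact f g ->
     type_le (dim M2) (type_cat (fil_type (Fi M1)) (fil_type (Fi M3)))
                      (fil_type (Fi M2)) /\
     (type_cat (fil_type (Fi M1)) (fil_type (Fi M3)) = fil_type (Fi M2) <->
      forall i : int,
        short_exact [set` Fi M1 i] [set` Fi M2 i] [set` Fi M3 i]
                    (bc_lin th f) (bc_lin th g))).
Proof.
have [psi [phiK psiK]] := bk_phi_inv S.
have H : hodge_properties (bk_theta' S) (fun M : phimod S => hodge_fil M).
  apply: (@hodge_properties_source _ _ _ _ _ S _ _ _ (bk_B' S) (bk_xi'_neq0 S)
    (bk_to_BdR' S) (dr_compl (bk_B' S) \o (dr_to_loc (bk_B' S) \o bk_phi S)))
      => x.
    exact: bk_to_BdR'E.
  exact: bk_to_BdR'E.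
have Hi : hodge_properties (bk_theta S) (fun M : phimod S => hodge_fil_iota M).
  have -> : (fun M : phimod S => hodge_fil_iota M) =
      fun M => lfil (B := bk_B S) (invmx (map_mx (bk_to_BdR S) (pm_phi M))).
    by apply: functional_extensionality_dep => M; apply: hodge_fil_iotaE.
  (* As [bk_to_BdR] already involves the inverse Frobenius, the second lattice is twisted by
     [psi]. *)
  apply: (@hodge_properties_target _ _ _ _ _ S _ _ _ (bk_B S) (bk_xi_neq0 S)
    (bk_to_BdR S) (dr_compl (bk_B S) \o (dr_to_loc (bk_B S) \o psi))) => x.
    exact: bk_to_BdRE.
  by rewrite -{1}(psiK x); exact: bk_to_BdRE.
by split; [exact: H.1 | split; [exact: H.2 | exact: Hi]].
Qed.
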